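(* Let $n_1\le n_2\le n_3$ be natural numbers with $n_1>3$. If $n_1\le 9$, then the triple $(n_1,n_2,n_3)$ is of type $A$. If $n_1\ge 14$, then the triple $(n_1,n_2,n_3)$ is of type $B$.
   Context: Let $V$ be a $3$-dimensional complex vector space with a hermitian form $\langle-,-\rangle$ of signature $+,+,-$. The complex hyperbolic plane $\mathbb H^2_{\mathbb C}$ is identified with $\mathrm{B}V=\{p\in\mathbb P_{\mathbb C}V\mid\langle p,p\rangle<0\}$; its ideal boundary is $\mathrm{S}V=\{p\in\mathbb P_{\mathbb C}V\mid\langle p,p\rangle=0\}$, and $\overline{\mathrm{B}}V=\mathrm{B}V\cup\mathrm{S}V$. A point of $\mathbb P_{\mathbb C}V$ and a representative of it in $V$ are denoted by the same letter when the expression does not depend on the choice. For nonisotropic points, the tance is $\mathrm{ta}(p_1,p_2)=\frac{\langle p_1,p_2\rangle\langle p_2,p_1\rangle}{\langle p_1,p_1\rangle\langle p_2,p_2\rangle}$. A complex geodesic is a set $\mathbb P_{\mathbb C}p^\perp\cap\overline{\mathrm{B}}V$ with $\langle p,p\rangle>0$; the point $p$ is its polar point. The reflection in this complex geodesic is the isometry in $\mathrm{PU}V$ induced by $x\mapsto 2\frac{\langle x,p\rangle}{\langle p,p\rangle}p-x$. If complex geodesics $C_1,C_2$ with polar points $p_1,p_2$ satisfy $\mathrm{ta}(p_1,p_2)\le1$, the angle $\angle(C_1,C_2)\in[0,\pi/2]$ between them is given by $\cos^2\angle(C_1,C_2)=\mathrm{ta}(p_1,p_2)$. Indices are taken modulo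 $3$. An $(n_1,n_2,n_3)$-triangle is a triple $(C_1,C_2,C_3)$ of complex geodesics, with polar points $p_1,p_2,p_3$, such that $C_i$ and $C_{i+1}$ meet at the angle $\pi/n_i$ for $i=1,2,3$. All triangles are assumed to be nondegenerate, i.e. the form restricted to the subspace $\mathbb Cp_1+\mathbb Cp_2+\mathbb Cp_3$ is nondegenerate. Put $r_i=\sqrt{\mathrm{ta}(p_i,p_{i+1})}=\cos\frac{\pi}{n_i}$, $\varkappa=\frac{\langle p_1,p_2\rangle\langle p_2,p_3\rangle\langle p_3,p_1\rangle}{\langle p_1,p_1\rangle\langle p_2,p_2\rangle\langle p_3,p_3\rangle}$, $\varepsilon=\varkappa/|\varkappa|$, $t=\mathrm{Re}\,\varepsilon$. For fixed $(n_1,n_2,n_3)$ with $n_1>3$, nondegenerate triangles are parametrized, up to isometries of $\mathbb H^2_{\mathbb C}$ (holomorphic or anti-holomorphic), by $t\in[-1,t_{max}]$, where $t_{max}=\min\{t_M,1\}$ and $t_M=\frac{r_1^2+r_2^2+r_3^2-1}{2r_1r_2r_3}$. The canonical deformation of the triangle family starts with $t=-1$ and ends with $t=t_{max}$. Let $I_i$ be the reflection in $C_i$ and put $W_A=I_3I_2I_1I_2$, $W_B=I_1I_2I_3$. An isometry in $\mathrm{PU}V$ is regular elliptic if it has a fixed point in $\mathrm{B}V$ and its lifts to $\mathrm{SU}V$ have three distinct eigenvalues. The triple $(n_1,n_2,n_3)$ is of type $A$ if, along the canonical deformation ($t$ increasing from $-1$ to $t_{max}$), $W_A$ becomes regular elliptic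 before $W_B$ does: there is $t\in[-1,t_{max}]$ at which $W_A$ is regular elliptic while $W_B$ is not regular elliptic at any $t'\in[-1,t]$. It is of type $B$ if $W_B$ becomes regular elliptic before $W_A$ does (same condition with $W_A$ and $W_B$ interchanged). *)

(* Defs.v *)
From HB Require Import structures.
From mathcomp Require Import all_boot all_order all_algebra.
From mathcomp Require Import sesquilinear complex.
From mathcomp Require Import boolp classical_sets reals trigo.
From mathcomp Require Import ring.

Set Implicit Arguments.
Unset Strict Implicit.
Unset Printing Implicit Defensive.

Import Order.TTheory GRing.Theory Num.Theory passmx.

Local Open Scope ring_scope.
Local Open Scope complex_scope.
Local Open Scope classical_set_scope.

(* A complex vector space is a [vectType] over [R[i]], the complex numbers over
   a real field [R : realType]. Points of the projective space P(V) are given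
   by nonzero representatives in [V]; every notion below is invariant under
   rescaling of the representatives. On [R[i]], [x < y] means that [y - x] is
   real and positive. *)

Section HermitianSpace.
Context {R : realType} {V : vectType R[i]}.
Variable h : {hermitian_sym V for Num.conj}.

Definition signature_ppm : Prop :=
  exists e1 e2 e3 : V,
    [/\ basis_of fullv [:: e1; e2; e3],
        [/\ h e1 e2 = 0, h e1 e3 = 0 & h e2 e3 = 0] &
        [/\ 0 < h e1 e1, 0 < h e2 e2 & h e3 e3 < 0]].

(* Sets of points of P(V), as sets of representatives: BV and its closure. *)
Definition BV : set V := [set x | x != 0 /\ h x x < 0].
Definition BV_closed : set V := [set x | x != 0 /\ h x x <= 0].

(* The complex geodesic with polar point [p], for [0 < h p p]. *)
Definition complex_geodesic (p : V) : set V :=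
  [set x | h x p = 0] `&` BV_closed.

Definition tance (p q : V) : R[i] := h p q * h q p / (h p p * h q q).

(* The angle between the complex geodesics with polar points [p] and [q] is
   [a]; it is only defined when [tance p q <= 1]. *)
Definition is_angle (p q : V) (a : R) : Prop :=
  [/\ tance p q <= 1, 0 <= a <= pi / 2 & (cos a ^+ 2)%:C = tance p q].

Definition meet_at_angle (p q : V) (a : R) : Prop :=
  complex_geodesic p `&` complex_geodesic q !=set0 /\ is_angle p q a.

Definition nondegenerate_on (U : {vspace V}) : Prop :=
  forall x, x \in U -> (forall y, y \in U -> h x y = 0) -> x = 0.

(* A nondegenerate (n1, n2, n3)-triangle, given by its polar points. *)
Definition triangle (n1 n2 n3 : nat) (p1 p2 p3 : V) : Prop :=
  [/\ [/\ 0 < h p1 p1, 0 < h p2 p2 & 0 < h p3 p3],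
      [/\ meet_at_angle p1 p2 (pi / n1%:R),
          meet_at_angle p2 p3 (pi / n2%:R) &
          meet_at_angle p3 p1 (pi / n3%:R)] &
      nondegenerate_on <<[:: p1; p2; p3]>>%VS].

Definition varkappa (p1 p2 p3 : V) : R[i] :=
  h p1 p2 * h p2 p3 * h p3 p1 / (h p1 p1 * h p2 p2 * h p3 p3).

Definition triangle_param (p1 p2 p3 : V) : R :=
  complex.Re (varkappa p1 p2 p3 / `|varkappa p1 p2 p3|).

Definition reflection_fun (p x : V) : V := (2 * (h x p / h p p)) *: p - x.

Fact reflection_fun_is_linear p : linear (reflection_fun p).
Proof.
move=> a x y; rewrite /reflection_fun linearPl /= scalerBr scalerA opprD addrACA.
by congr (_ + _); rewrite -scalerDl; congr (_ *: p); ring.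
Qed.

HB.instance Definition _ p :=
  GRing.isLinear.Build _ _ _ _ (reflection_fun p) (reflection_fun_is_linear p).

(* Elements of PU(V) are given by linear maps representing them. *)
Definition reflection (p : V) : 'End(V) := linfun (reflection_fun p).

Definition word_A (p1 p2 p3 : V) : 'End(V) :=
  (reflection p3 \o reflection p2 \o reflection p1 \o reflection p2)%VF.

Definition word_B (p1 p2 p3 : V) : 'End(V) :=
  (reflection p1 \o reflection p2 \o reflection p3)%VF.

Definition lfun_det (g : 'End(V)) : R[i] :=
  \det (mxof (vbasis fullv) (vbasis fullv) g).

Definition in_SU (g : 'End(V)) : Prop :=
  (forall x y, h (g x) (g y) = h x y) /\ lfun_det g = 1.

(* [l] is a lift to SU(V) of the isometry represented by [g]. *)
Definition SU_lift (g l : 'End(V)) : Prop :=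
  in_SU l /\ exists2 c : R[i], c != 0 & l = c *: g.

Definition three_distinct_eigenvalues (g : 'End(V)) : Prop :=
  exists a b c : R[i], [/\ uniq [:: a; b; c],
    leigenvalue g a, leigenvalue g b & leigenvalue g c].

Definition regular_elliptic (g : 'End(V)) : Prop :=
  (exists2 x, BV x & exists a : R[i], g x = a *: x) /\
  (forall l, SU_lift g l -> three_distinct_eigenvalues l).

(* [W] is regular elliptic at the parameter [t] of the family of
   (n1, n2, n3)-triangles. All triangles with parameter [t] are congruent and
   the property is invariant under congruence, so that it does not matter which
   of them is used. *)
Definition regular_elliptic_at (n1 n2 n3 : nat) (W : V -> V -> V -> 'End(V))
    (t : R) : Prop :=
  exists p1 p2 p3 : V, [/\ triangle n1 n2 n3 p1 p2 p3,
    triangle_param p1 p2 p3 = t & regular_elliptic (W p1 p2 p3)].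

End HermitianSpace.

Section TriangleType.
Context {R : realType}.

Definition r_ (n : nat) : R := cos (pi / n%:R).

Definition t_M (n1 n2 n3 : nat) : R :=
  (r_ n1 ^+ 2 + r_ n2 ^+ 2 + r_ n3 ^+ 2 - 1) / (2 * r_ n1 * r_ n2 * r_ n3).

Definition t_max (n1 n2 n3 : nat) : R := Num.min (t_M n1 n2 n3) 1.

Context {V : vectType R[i]}.
Variable h : {hermitian_sym V for Num.conj}.

(* Along the canonical deformation, [W] becomes regular elliptic before [W']. *)
Definition elliptic_before (n1 n2 n3 : nat) (W W' : V -> V -> V -> 'End(V)) :
    Prop :=
  exists t : R, [/\ -1 <= t <= t_max n1 n2 n3,
    regular_elliptic_at h n1 n2 n3 W t &
    forall t', -1 <= t' <= t -> ~ regular_elliptic_at h n1 n2 n3 W' t'].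

Definition type_A (n1 n2 n3 : nat) : Prop :=
  elliptic_before n1 n2 n3 (word_A h) (word_B h).

Definition type_B (n1 n2 n3 : nat) : Prop :=
  elliptic_before n1 n2 n3 (word_B h) (word_A h).

End TriangleType.

(* Main.v *)
Require Import Defs.
From mathcomp Require Import all_boot all_order all_algebra.
From mathcomp Require Import sesquilinear complex.
From mathcomp Require Import boolp classical_sets reals trigo.
From mathcomp Require Import ring lra.

Set Implicit Arguments.
Unset Strict Implicit.
Unset Printing Implicit Defensive.

Import Order.TTheory GRing.Theory Num.Theory passmx.

Local Open Scope ring_scope.

(** Both words lie in SU(V), and an element of SU(V) with trace z is regular
elliptic exactly when Goldman's discriminant
  f(z) = |z|^4 - 8 Re z^3 + 18 |z|^2 - 27
is negative ([regular_ellipticP]): f(z) is the discriminant of the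
characteristic polynomial X^3 - z X^2 + z^* X - 1, and it is negative if and
only if the three eigenvalues are distinct of modulus 1. The region f < 0 is
the interior of a deltoid with cusps at three times the cube roots of unity.
So both words are controlled by their traces along the deformation.

Write a, b, c for the squares of r_1, r_2, r_3 and m for r_1 r_2 r_3. The word
W_A is the product of the reflection in C_3 with the reflection in the image of
C_1 under I_2; its trace is 4 ta - 1, where ta = 4 a b + c - 4 m t is positive.
Hence W_A is regular elliptic if and only if ta < 1, that is, once t exceeds a
threshold ([word_A_ellipticP]). The trace of W_B is
  3 - 4 (a + b + c) + 8 varkappa^*,
which runs over a circle centred on the real axis ([word_B_ellipticP]). We use
as parameter v = 2 Re (tr W_B) + 3, an increasing affine function of t which
vanishes at the real part of the two nonreal cusps of the deltoid; the
endpoint t_M corresponds to v = 1. In general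
  f(x + i y) = (y^2 + x^2 + 12 x + 9)^2 - 4 (2 x + 3)^3,
and on a circle centred on the real axis the first square is the square of an
affine function of x. Thus W_B is regular elliptic at v if and only if
(D - K v)^2 < 4 v^3 for two constants D and K of the triple.

The theorem is now a matter of real inequalities in the three numbers
x = 2 (1 - a), y = 2 (1 - b), z = 2 (1 - c), which satisfy 0 < z <= y <= x.
If n_1 <= 9 then x > 23/100, and up to some value of v beyond the threshold
of W_A the path of W_B stays outside the deltoid ([typeA_witness]): either it
has not passed the real part of the cusps, or D - K v is too large. If
n_1 >= 14 then x <= 1/10, and no later than at the threshold the path of W_B crosses the
axis of the cusp inside the deltoid ([typeB_witness]). Every parameter
t in [-1, 1] below t_M is realized by explicit vectors in an orthonormal basis
([triangle_exists]). *)

(** * Discriminants along the deformation *)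

Section RealPart.
Context {R : realType}.
Implicit Types x y z v w : R.

(** With x = 2 (1 - a), y = 2 (1 - b), z = 2 (1 - c), where a, b, c are the
squares of the three cosines, and v = 2 Re (tr W_B) + 3:
[disc_B] is Goldman's discriminant of tr W_B, [four_im_sq] is four times the
square of its imaginary part, and [threshold_A] is the value of v beyond which
W_A is regular elliptic. *)
Definition disc_const x y z : R :=
  1 - 2 * (x + y + z) - 4 * (x + y + z) ^+ 2 + 16 * (x * y + y * z + z * x)
    - 8 * (x * y * z).
Definition disc_slope x y z : R := 3 - 2 * (x + y + z).
Definition disc_B x y z v : R :=
  (disc_const x y z - disc_slope x y z * v) ^+ 2 - 4 * v ^+ 3.
Definition threshold_A x y z : R := 1 - 4 * x - 4 * y + 4 * (x * y) + 2 * z.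
Definition four_im_sq x y z v : R :=
  4 * (disc_const x y z - disc_slope x y z * v) - v ^+ 2 - 18 * v + 27.

(** The deltoid lies to the right of its nonreal cusps. *)
Lemma disc_B_ge0_npos x y z v : v <= 0 -> 0 <= disc_B x y z v.
Proof.
move=> v0; have v3 : v ^+ 3 <= 0 by rewrite exprS mulr_le0_ge0 ?sqr_ge0.
rewrite /disc_B; have := sqr_ge0 (disc_const x y z - disc_slope x y z * v).
by move: v3 (_ ^+ 2) => {}v3 s; lra.
Qed.

(** The polynomial is concave in each variable, so that its minimum over the
cube is taken at a vertex; it is -5, at (1, 0, 0). *)
Lemma disc_const_ge x y z : 0 <= x <= 1 -> 0 <= y <= 1 -> 0 <= z <= 1 ->
  - 5 <= disc_const x y z.
Proof.
move=> /andP[x0 x1] /andP[y0 y1] /andP[z0 z1].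
have -> : disc_const x y z = - 5 + 4 * (x * (1 - x) + y * (1 - y) + z * (1 - z))
   + 6 * ((1 - x) * (1 - y) * (1 - z))
   + 2 * (x * y * (1 - z) + y * z + z * x).
  by rewrite /disc_const; ring.
have [x1' y1' z1'] : [/\ 0 <= 1 - x, 0 <= 1 - y & 0 <= 1 - z] by rewrite !subr_ge0.
move: x1' y1' z1'; move: (1 - x) (1 - y) (1 - z) => x' y' z' x1' y1' z1'.
by rewrite -!addrA lerDl !(addr_ge0, mulr_ge0).
Qed.

Lemma four_im_sq0_ge0 x y z : 0 <= x <= 1 -> 0 <= y <= 1 -> 0 <= z <= 1 ->
  0 <= four_im_sq x y z 0.
Proof.
move=> hx hy hz; have := disc_const_ge hx hy hz.
by rewrite /four_im_sq; move: (disc_const _ _ _) => D DL; lra.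
Qed.

(** If W_A becomes regular elliptic only after the path of W_B has passed the
cusps, then y and z are small: the threshold v_A is at most
v - 2 y (1 - 2 x), where v = 1 - 4 x is its value for y = z = 0, and this forces
x <= 1/4 and y <= v <= 2/25. At this v the quantity D - K v is at least 8/100;
as it decreases in v while 4 v^3 increases, the discriminant is nonnegative
at all smaller values too. *)
Lemma typeA_witness_threshold_ge0 x y z :
  23/100 < x <= 1 -> 0 < z -> z <= y -> y <= x -> 0 <= threshold_A x y z ->
  exists v, [/\ v < 1, 0 <= four_im_sq x y z v, threshold_A x y z < v &
    forall w, w <= v -> 0 <= disc_B x y z w].
Proof.
move=> /andP[xL x1] z0 zy yx vA0.
pose v := 1 - 4 * x; have xE : x = (1 - v) / 4 by rewrite /v; field.
have vAE : threshold_A x y z = v - 2 * (y * (1 - 2 * x)) - 2 * (y - z).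
  by rewrite /threshold_A /v; ring.
have xle : x <= 1/4.
  by move: vA0; rewrite vAE /v; nra.
have v0 : 0 <= v by rewrite /v; lra.
have vL : v <= 2/25 by rewrite /v; lra.
have y12 : 1/2 * y <= y * (1 - 2 * x) by rewrite mulrC ler_wpM2l; lra.
have yv : y <= v by lra.
have vAv : threshold_A x y z < v by lra.
have y0 : 0 <= y by lra.
have v2 : v ^+ 2 <= 2/25 * v by rewrite expr2 ler_wpM2r.
have yz2 : (y - z) ^+ 2 <= v ^+ 2.
  by rewrite lerXn2r ?nnegrE//; [rewrite subr_ge0 | clear vAE; lra].
have yzv : y * z <= v ^+ 2.
  by rewrite expr2 ler_pM//; [exact: ltW | exact: le_trans yv].
have xyz : x * (y * z) <= 1/4 * v ^+ 2.
  by rewrite ler_pM// ?mulr_ge0//; clear -xL z0; lra.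
(* The terms of degree one in y and z cancel for v = 1 - 4 x. *)
have DKE : disc_const x y z - disc_slope x y z * v =
    1/4 - 3/2 * v - 3/4 * v ^+ 2 - 4 * (y - z) ^+ 2 - 8 * (x * (y * z)).
  by rewrite /disc_const /disc_slope xE; field.
have h1 : 8/100 <= disc_const x y z - disc_slope x y z * v.
  rewrite DKE; move: (_ ^+ 2) ((y - z) ^+ 2) (x * _) v2 yz2 xyz vL.
  by clear; move=> *; lra.
have K0 : 0 <= disc_slope x y z by rewrite /disc_slope; clear -xL xle yv vL zy v0; lra.
exists v; split=> //.
- by rewrite (le_lt_trans vL)//; clear; lra.
- by rewrite /four_im_sq; clear -h1 v0 vL v2; lra.
move=> w wv; have [w0|w0] := leP w 0; first exact: disc_B_ge0_npos.
have wK : disc_slope x y z * w <= disc_slope x y z * v by rewrite ler_wpM2l.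
have h2 : (8/100) ^+ 2 <= (disc_const x y z - disc_slope x y z * w) ^+ 2.
  by rewrite lerXn2r ?nnegrE//; clear -h1 wK; lra.
have h3 : w ^+ 3 <= (2/25) ^+ 3 by rewrite lerXn2r ?nnegrE//; clear -w0 wv vL; lra.
by rewrite /disc_B; clear -h2 h3; lra.
Qed.

(** When the threshold of W_A is negative, W_A is regular elliptic as soon as
the path of W_B reaches the real part of the cusps. *)
Lemma typeA_witness x y z : 23/100 < x <= 1 -> 0 < z -> z <= y -> y <= x ->
  exists v, [/\ v < 1, 0 <= four_im_sq x y z v, threshold_A x y z < v &
    forall w, w <= v -> 0 <= disc_B x y z w].
Proof.
move=> hx z0 zy yx; have [vA0|vA0] := leP 0 (threshold_A x y z).
  exact: typeA_witness_threshold_ge0.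
have [xL x1] := andP hx.
exists 0; split; rewrite ?ltr01//; last first.
  by move=> w; exact: disc_B_ge0_npos.
by apply: four_im_sq0_ge0; apply/andP; split; clear -x1 z0 zy yx xL; lra.
Qed.

(** On the axis of a nonreal cusp, where (Im z)^2 = 3 (Re z)^2, one has
D - K v = v^2, so that the discriminant is v^3 (v - 4), negative for v in
]0, 4[. The witness is the positive root of v^2 + K v - D; it does not exceed
the threshold V of W_A because V^2 + K V - D is nonnegative. *)
Lemma typeB_witness x y z : x <= 1/10 -> 0 < z -> z <= y -> y <= x ->
  exists v, [/\ v < 1, 0 <= four_im_sq x y z v, v <= threshold_A x y z &
    disc_B x y z v < 0].
Proof.
move=> xL z0 zy yx.
have y0 : 0 <= y by clear -zy z0; lra.
have x0 : 0 <= x by clear -yx y0; lra.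
pose D := disc_const x y z; pose K := disc_slope x y z; pose V := threshold_A x y z.
have D0 : 0 < D.
  have -> : D = 1 - 2 * (x + y + z) - 4 * (x + y + z) ^+ 2
     + 8 * (x * y + 2 * (y * z) + 2 * (z * x)) + 8 * (x * y * (1 - z)).
    by rewrite /D /disc_const; ring.
  have p1 : 0 <= x * y by rewrite mulr_ge0.
  have p2 : 0 <= y * z by rewrite mulr_ge0// ltW.
  have p3 : 0 <= z * x by rewrite mulr_ge0// ltW.
  have p4 : 0 <= x * y * (1 - z).
    by rewrite mulr_ge0//; clear -xL zy yx; lra.
  have p5 : (x + y + z) ^+ 2 <= 3/10 * (x + y + z).
    by rewrite expr2 ler_wpM2r//; clear -xL yx zy y0 z0; lra.
  move: p1 p2 p3 p4 p5; move: (x * y) (y * z) (z * x) (_ * (1 - z)) (_ ^+ 2).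
  by clear -xL yx zy y0 z0 x0 => *; lra.
have K0 : 0 < K by rewrite /K /disc_slope; clear -xL yx zy; lra.
have V0 : 0 < V.
  have xy0 : 0 <= x * y by rewrite mulr_ge0.
  by rewrite /V /threshold_A; clear -xL yx zy z0 xy0; lra.
have V1 : V < 1.
  have xy : x * y <= 1/10 * y by rewrite ler_wpM2r.
  by rewrite /V /threshold_A; clear -yx zy xy y0 z0 x0; nra.
have V2 : D <= V ^+ 2 + K * V.
  rewrite -subr_ge0.
  (* Expansion at x + y = 1/5, the largest value allowed. *)
  have -> : V ^+ 2 + K * V - D = 12/100
      + (1/5 - (x + y)) * (72/5 - 28 * (x + y))
      + x * y * (8 - 40 * (x + y)) - 4 * (x * y) + 16 * (x * y) ^+ 2
      + z * (10 - 20 * (x + y) + 16 * (x * y)) + 4 * z ^+ 2.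
    by rewrite /V /threshold_A /K /disc_slope /D /disc_const; field.
  have sL : x + y <= 1/5 by clear -xL yx; lra.
  have p1 : 0 <= x * y by rewrite mulr_ge0.
  have p2 : x * y <= 1/10 * (1/10) by rewrite ler_pM//; clear -xL yx; lra.
  have p3 : 0 <= (1/5 - (x + y)) * (72/5 - 28 * (x + y)).
    by rewrite mulr_ge0//; clear -sL; lra.
  have p4 : 0 <= x * y * (8 - 40 * (x + y)) by rewrite mulr_ge0//; clear -sL; lra.
  have p5 : 0 <= z * (10 - 20 * (x + y) + 16 * (x * y)).
    by rewrite mulr_ge0 ?ltW//; clear -sL p1; lra.
  have p6 := sqr_ge0 (x * y); have p7 := sqr_ge0 z.
  move: p1 p2 p3 p4 p5 p6 p7.
  move: (x * y) (_ * (72/5 - _)) (_ * (8 - _)) (z * _) (_ ^+ 2) (_ ^+ 2).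
  by clear => *; lra.
pose s := Num.sqrt (K ^+ 2 + 4 * D); pose v := (s - K) / 2.
have sE : s ^+ 2 = K ^+ 2 + 4 * D.
  by rewrite sqr_sqrtr// addr_ge0 ?sqr_ge0// mulr_ge0// ltW.
have s0 : 0 <= s := sqrtr_ge0 _.
have vE : v ^+ 2 = D - K * v by rewrite /v; clear -sE; nra.
have v0 : 0 < v.
  have : K < s; last by rewrite /v; clear; lra.
  by rewrite -(ltr_pXn2r (ltn0Sn 1)) ?nnegrE ?(ltW K0)// sE; clear -D0; lra.
have vV : v <= V.
  rewrite leNgt; apply/negP => Vv.
  have : V ^+ 2 < v ^+ 2 by rewrite (ltr_pXn2r (ltn0Sn 1)) ?nnegrE ?ltW.
  by have : K * V < K * v by [rewrite ltr_pM2l]; clear -V2 vE; lra.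
exists v; rewrite /four_im_sq /disc_B -/D -/K -vE; split=> //.
- exact: le_lt_trans V1.
- have : v ^+ 2 <= 1 * v by rewrite expr2 ler_wpM2r ?ltW// (le_lt_trans vV).
  by have := sqr_ge0 v; clear -vV V1; lra.
- rewrite -exprM (_ : _ - _ = v ^+ 3 * (v - 4)); last by rewrite !exprS; ring.
  by rewrite pmulr_rlt0 ?exprn_gt0//; clear -vV V1; lra.
Qed.

End RealPart.

(** * The angles of the triangle *)

Section Trig.
Context {R : realType}.

Lemma pi_div_itv n : (2 <= n)%N -> 0 < (pi / n%:R : R) <= pi / 2.
Proof.
move=> n2; have n0 : 0 < n%:R :> R by rewrite ltr0n (leq_trans _ n2).
rewrite divr_gt0 ?pi_gt0//= ler_pM2l ?pi_gt0// lef_pV2 ?posrE//.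
by rewrite ler_nat.
Qed.

Lemma r_le n m : (2 <= n)%N -> (n <= m)%N -> r_ n <= r_ m :> R.
Proof.
move=> n2 nm; have m2 := leq_trans n2 nm.
have in0pi k : (2 <= k)%N -> pi / k%:R \in `[0, pi : R].
  move=> /pi_div_itv/andP[k0 k2]; rewrite in_itv/= (ltW k0) (le_trans k2)//.
  by rewrite ler_pdivrMr// ler_peMr ?pi_ge0// ler1n.
rewrite /r_ leNgt ltr_cos ?in0pi// -leNgt ler_pM2l ?pi_gt0//.
have pos k : (2 <= k)%N -> k%:R \is @Num.pos R.
  by move=> k2; rewrite posrE ltr0n (leq_trans _ k2).
by rewrite lef_pV2 ?pos// ler_nat.
Qed.

Lemma r_gt0 n : (2 < n)%N -> 0 < r_ n :> R.
Proof.
move=> n2; apply: cos_gt0_pihalf.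
have /andP[h _] := pi_div_itv (ltnW n2).
rewrite (lt_trans _ h) ?oppr_lt0 ?divr_gt0 ?pi_gt0//=.
rewrite ltr_pM2l ?pi_gt0// ltf_pV2 ?posrE ?ltr0n ?(leq_trans _ n2)//.
by rewrite ltr_nat.
Qed.

Lemma r_lt1 n : (2 <= n)%N -> r_ n < 1 :> R.
Proof.
move=> n2; have /andP[h0 h1] := pi_div_itv n2.
rewrite -cos0 /r_ ltr_cos// in_itv/= ?lexx ?pi_ge0// (ltW h0) (le_trans h1)//.
by rewrite ler_pdivrMr// ler_peMr ?pi_ge0// ler1n.
Qed.

Lemma r4_sq : r_ 4 ^+ 2 = 1 / 2 :> R.
Proof.
have /eqP : cos (pi / 2) = 0 :> R by exact: cos_pihalf.
have -> : pi / 2 = (pi / 4) *+ 2 :> R by field.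
by rewrite cos_mulr2n subr_eq0 /r_ => /eqP h; lra.
Qed.

Lemma cos_mulr3n (x : R) : cos (x *+ 3) = 4 * cos x ^+ 3 - 3 * cos x.
Proof.
rewrite mulrSr cosD cos_mulr2n sin_mulr2n mulrnAl -mulrA -expr2 sin2cos2.
by ring.
Qed.

(** The bound comes from 4 c^3 - 3 c = cos (pi / 3) = 1/2 for c = cos (pi / 9):
if c^2 were at least 177/200, the left-hand side would exceed 1/2. *)
Lemma r9_lt : r_ 9 ^+ 2 < 177 / 200 :> R.
Proof.
have c3 : 4 * r_ 9 ^+ 3 - 3 * r_ 9 = r_ 3 :> R.
  by rewrite -cos_mulr3n; congr cos; field.
have r3 : r_ 3 = 1 / 2 :> R.
  have c3' : 4 * r_ 3 ^+ 3 - 3 * r_ 3 = -1 :> R.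
    by rewrite -cos_mulr3n -[RHS]cospi; congr cos; field.
  have r30 := r_gt0 (isT : (2 < 3)%N).
  have : (r_ 3 + 1) * (2 * r_ 3 - 1) ^+ 2 = 0 :> R.
    rewrite -[RHS](subrr (-1 : R)) -[X in _ = X - _]c3'; ring.
  move/eqP; rewrite mulf_eq0 gt_eqF ?addr_gt0//= sqrf_eq0 subr_eq0 => /eqP.
  lra.
have r9_gt0 := @r_gt0 9 isT.
rewrite ltNge; apply/negP => h.
have h' : 94/100 <= r_ 9 :> R.
  rewrite -(ler_pXn2r (ltn0Sn 1)) ?nnegrE ?(ltW r9_gt0)//; last by lra.
  by apply: le_trans h; lra.
have : (94/100 : R) * (27/50 : R) <= r_ 9 * (4 * r_ 9 ^+ 2 - 3).
  by apply: (@ler_pM R) => //; lra.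
move: c3; rewrite r3 exprS => c3 h3.
have e : r_ 9 * (4 * r_ 9 ^+ 2 - 3) = 4 * (r_ 9 * r_ 9 ^+ 2) - 3 * r_ 9 :> R by ring.
by rewrite e c3 in h3; lra.
Qed.

(** Since cos (4 pi / 7) = - cos (3 pi / 7), the number c = cos (pi / 7) is a root
of 8 c^3 - 4 c^2 - 4 c + 1, which is negative on [7/10, 9/10]; hence
c >= 9/10, and c = 2 cos^2 (pi / 14) - 1. *)
Lemma r14_ge : 19 / 20 <= r_ 14 ^+ 2 :> R.
Proof.
set c := cos (pi / 7) : R.
have cE : c = 2 * r_ 14 ^+ 2 - 1.
  have -> : c = cos ((pi / 14) *+ 2) by congr cos; field.
  by rewrite cos_mulr2n mulr_natl.
have c34 : 2 * (2 * c ^+ 2 - 1) ^+ 2 - 1 = - (4 * c ^+ 3 - 3 * c).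
  rewrite -cos_mulr3n; have <- : cos (pi / 7 *+ 2 *+ 2) = - cos (pi / 7 *+ 3) :> R.
    rewrite -cosDpi -(cosN (_ + pi)) -(cosD2pi (- _)); congr cos; by field.
  by rewrite !cos_mulr2n !mulr_natl.
have c0 : 7/10 < c.
  apply: lt_le_trans (@r_le 4 7 isT isT).
  rewrite -(ltr_pXn2r (ltn0Sn 1)) ?nnegrE ?(ltW (@r_gt0 4 isT))//; last by lra.
  by rewrite r4_sq; lra.
have : (c + 1) * (8 * c ^+ 3 - 4 * c ^+ 2 - 4 * c + 1) = 0.
  by rewrite -(subrr (- (4 * c ^+ 3 - 3 * c))) -{1}c34; ring.
move/eqP; rewrite mulf_eq0 gt_eqF/=; last by lra.
move/eqP => pc; suff : 9/10 <= c by rewrite cE; lra.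
rewrite leNgt; apply/negP => c9.
(* The cubic is convex there and negative at both ends. *)
have : 0 < (c - 7/10) * (9/10 - c) * c by rewrite !mulr_gt0; lra.
nra.
Qed.

(** This is 1 - cos (2 pi / n), by the duplication formula. *)
Definition cosine_defect (n : nat) : R := 2 * (1 - r_ n ^+ 2).

Lemma cosine_defect_gt0 n : (3 < n)%N -> 0 < cosine_defect n.
Proof.
move=> n4; have n3 : (2 < n)%N by exact: ltnW.
apply: mulr_gt0 => //; rewrite subr_gt0.
by rewrite expr_lt1 ?r_lt1 ?(ltW (r_gt0 n3))// ltnW.
Qed.

Lemma cosine_defect_le n n' : (3 < n)%N -> (n <= n')%N ->
  cosine_defect n' <= cosine_defect n.
Proof.
move=> n4 nn; have n3 : (2 < n)%N by exact: ltnW.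
have n'3 : (2 < n')%N by exact: leq_trans nn.
rewrite /cosine_defect ler_pM2l// lerD2l lerN2.
by rewrite lerXn2r ?nnegrE ?(ltW (r_gt0 _))// r_le// ltnW.
Qed.

End Trig.

(** * The trace discriminant of an isometry *)

Section Goldman.
Context {C : numClosedFieldType}.
Implicit Types a b c z : C.

(** The discriminant of X^3 - z X^2 + z^* X - 1. *)
Definition goldman z : C :=
  z ^+ 2 * z^* ^+ 2 - 4 * (z ^+ 3 + z^* ^+ 3) + 18 * (z * z^*) - 27.

Lemma goldman_vandermonde a b c : a * b * c = 1 ->
  (a + b + c)^* = a * b + b * c + c * a ->
  goldman (a + b + c) = ((a - b) * (b - c) * (c - a)) ^+ 2.
Proof.
move=> abc zE; rewrite /goldman zE.
set s := a + b + c; set q := a * b + b * c + c * a.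
have -> : ((a - b) * (b - c) * (c - a)) ^+ 2 =
    s ^+ 2 * q ^+ 2 - 4 * q ^+ 3 - 4 * s ^+ 3 * (a * b * c)
    + 18 * (s * q * (a * b * c)) - 27 * (a * b * c) ^+ 2 by rewrite /s /q; ring.
by rewrite abc; ring.
Qed.

Lemma conj_unit z : `|z| = 1 -> z^* = z^-1.
Proof. by move=> z1; rewrite invC_norm z1 expr1n invr1 mul1r. Qed.

(** The product w of the differences satisfies w^* = - w when the eigenvalues are
inverse to their conjugates, so that w^2 = - |w|^2. *)
Lemma goldman_lt0 a b c : `|a| = 1 -> `|b| = 1 -> `|c| = 1 ->
  uniq [:: a; b; c] -> a * b * c = 1 ->
  (a + b + c)^* = a * b + b * c + c * a -> goldman (a + b + c) < 0.
Proof.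
move=> a1 b1 c1 abc_uniq abc zE; rewrite goldman_vandermonde//.
have nz (z : C) : `|z| = 1 -> z != 0 by move=> z1; rewrite -normr_gt0 z1.
set w := (a - b) * _ * _.
have w0 : w != 0.
  move: abc_uniq; rewrite /= !inE negb_or !andbT => /andP[/andP[ab ac] bc].
  by rewrite !mulf_neq0 ?subr_eq0// eq_sym.
have wJ : w^* = - w.
  transitivity (- w / (a * b * c) ^+ 2); last by rewrite abc expr1n divr1.
  by rewrite /w !rmorphM !rmorphB /= !conj_unit//; field; rewrite !nz.
by rewrite expr2 -[X in _ * X]opprK -wJ mulrN oppr_lt0 -normCK exprn_gt0 ?normr_gt0.
Qed.

(** The set of eigenvalues is stable under inversion in the unit circle. If a is
not on the circle, then its inverse point is another eigenvalue and the third
one is on the circle; the product of the differences is then real, and its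
square is not negative. *)
Lemma goldman_lt0_unit a b c : a * b * c = 1 ->
  (a + b + c)^* = a * b + b * c + c * a -> goldman (a + b + c) < 0 ->
  `|a| = 1.
Proof.
move=> abc zE; rewrite goldman_vandermonde// => w2.
have [//|a1] := eqVneq `|a| 1.
have a0 : a != 0 by apply: contra_eq_neq abc => ->; rewrite !mul0r eq_sym oner_eq0.
have b0 : b != 0 by apply: contra_eq_neq abc => ->; rewrite mulr0 mul0r eq_sym oner_eq0.
have c0 : c != 0 by apply: contra_eq_neq abc => ->; rewrite mulr0 eq_sym oner_eq0.
have aJ0 : a^* != 0 by rewrite conjC_eq0.
have : ((a^*)^-1 - a) * ((a^*)^-1 - b) * ((a^*)^-1 - c) = 0.
  have qE : (a * b + b * c + c * a)^* = a + b + c by rewrite -zE conjCK.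
  have abcJ : (a * b * c)^* = 1 by rewrite abc rmorph1.
  have -> : ((a^*)^-1 - a) * ((a^*)^-1 - b) * ((a^*)^-1 - c) =
     ((a * b * c)^* - (a * b + b * c + c * a)^* * a^*
      + (a + b + c)^* * a^* ^+ 2 - a * b * c * a^* ^+ 3) / a^* ^+ 3.
    by rewrite abcJ qE zE; field.
  rewrite [X in X * a^* ^+ 3]abc !rmorphD !rmorphM /=.
  by rewrite (_ : _ - _ = 0) ?mul0r//; ring.
have aJ : (a^*)^-1 - a != 0.
  rewrite subr_eq0; apply: contra a1 => /eqP aE.
  rewrite -(@eqrXn2 _ 2)// expr1n normCK; apply/eqP.
  by rewrite -{1}aE mulVf.
have key (x y : C) : x != 0 -> y != 0 -> a * x * y = 1 -> (a^*)^-1 = x ->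
    ((a - x) * (x - y) * (y - a)) ^+ 2 < 0 -> False.
  move=> x0 y0 axy xE; set w := _ * _ * _ => wlt.
  have aJE : a^* = x^-1 by rewrite -xE invrK.
  have xJE : x^* = a^-1 by rewrite -xE fmorphV /= conjCK.
  have yE : y = (a * x)^-1.
    by apply: (mulfI (mulf_neq0 a0 x0)); rewrite axy mulfV ?mulf_neq0.
  have yJE : y^* = y^-1.
    by rewrite yE fmorphV rmorphM /= aJE xJE; field; rewrite a0 x0.
  have wJ : w^* = w.
    transitivity (w / (a * x * y) ^+ 2); last by rewrite axy expr1n divr1.
    by rewrite /w !rmorphM !rmorphB /= aJE xJE yJE; field; rewrite a0 x0 y0.
  have : 0 <= w ^+ 2 by rewrite expr2 -{2}wJ mul_conjC_ge0.
  by move=> /(lt_le_trans wlt); rewrite ltxx.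
move/eqP; rewrite -mulrA mulf_eq0 (negPf aJ)/= mulf_eq0 !subr_eq0.
case/orP => /eqP aE; exfalso.
  exact: (key b c).
apply: (key c b) => //; first by rewrite -abc; ring.
by rewrite (_ : _ ^+ 2 = ((a - b) * (b - c) * (c - a)) ^+ 2)//; ring.
Qed.

(** For e = 1 and e = -1, taking conjugates in det (e - M) gives det (e - M^-1),
which is a multiple of det (e - M). The resulting two relations determine the
coefficient of X. *)
Lemma char_poly_isometry n (M H : 'M[C]_n) : n = 3%N -> H \in unitmx ->
  M *m H *m (map_mx Num.conj M)^T = H -> \det M = 1 ->
  char_poly M = 'X^3 - (\tr M) *: 'X^2 + (\tr M)^* *: 'X - 1.
Proof.
move=> n3; move: M H; rewrite {}n3 => M H Hu MH dM; set p := char_poly M.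
have size_p : size p = 4 by rewrite size_char_poly.
have p0 : p`_0 = - 1 by rewrite char_poly_det dM mulr1 -signr_odd expr1.
have p2 : p`_2 = - \tr M by rewrite -char_poly_trace.
have p3 : p`_3 = 1.
  by have /monicP := char_poly_monic M; rewrite lead_coefE size_p.
have pE (x : C) : p.[x] = \det (x%:M - M).
  rewrite /p /char_poly -horner_evalE -det_map_mx; congr (\det _).
  apply/matrixP => i j; rewrite !mxE /= horner_evalE.
  by case: (i == j); rewrite ?mulr1n ?mulr0n !hornerE.
have psym (e : C) : e^* = e -> e ^+ 2 = 1 -> (p.[e])^* = - e ^+ 3 * p.[e].
  move=> eJ e2; have dH : \det H != 0 by rewrite -unitfE -unitmxE.
  apply: (mulIf dH); rewrite pE -det_map_mx -det_tr mulrC -det_mulmx.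
  rewrite -[LHS]mul1r -dM -det_mulmx.
  have -> : M *m (H *m (map_mx Num.conj (e%:M - M))^T) = - e *: (e%:M - M) *m H.
    rewrite map_mxB map_scalar_mx /= eJ linearB/= tr_scalar_mx !mulmxBr.
    rewrite [X in _ - X = _]mulmxA MH mul_mx_scalar -scalemxAr.
    rewrite -scalemxAl mulmxBl mul_scalar_mx scalerBr scalerA !scaleNr mulNr.
    by rewrite -expr2 e2 scaleN1r opprK addrC.
  by rewrite -scalemxAl detZ exprNn -signr_odd expr1 mulN1r det_mulmx mulrA.
have horner_p (x : C) : p.[x] = - 1 + p`_1 * x - \tr M * x ^+ 2 + x ^+ 3.
  rewrite horner_coef size_p !big_ord_recr big_ord0 /= add0r p0 p2 p3.
  by rewrite expr0 expr1; ring.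
have p1 : p`_1 = (\tr M)^*.
  have N1 : (- 1 : C)^* = - 1 by rewrite rmorphN rmorph1.
  have := psym (- 1) N1 (etrans (sqrrN _) (expr1n _ _)).
  have := psym 1 (rmorph1 _) (expr1n _ _).
  rewrite !horner_p !(rmorphD, rmorphM, rmorphN, rmorphXn)/= rmorph1 => h1 h2.
  apply: (mulfI (_ : 2 != 0 :> C)); rewrite ?pnatr_eq0//; apply/eqP.
  rewrite -subr_eq0; apply/eqP.
  move/eqP: h1; rewrite -subr_eq0 => /eqP h1.
  move/eqP: h2; rewrite -subr_eq0 => /eqP h2.
  rewrite -[RHS](addr0 0) -[X in _ = X + _]h1 -[X in _ = _ + X]h2.
  by ring.
apply/polyP => i; rewrite !(coefD, coefN, coefZ, coefXn, coefX, coef1).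
case: i => [|[|[|[|i]]]]; rewrite ?p0 ?p1 ?p2 ?p3 /=; try ring.
by rewrite nth_default ?size_p//; ring.
Qed.

Lemma isometry_eigenvalues n (M H : 'M[C]_n) a b c : n = 3%N -> H \in unitmx ->
  M *m H *m (map_mx Num.conj M)^T = H -> \det M = 1 ->
  char_poly M = \prod_(x <- [:: a; b; c]) ('X - x%:P) ->
  [/\ a * b * c = 1, a + b + c = \tr M &
      (a + b + c)^* = a * b + b * c + c * a].
Proof.
move=> n3 Hu MH dM; rewrite (char_poly_isometry n3 Hu MH dM) !big_cons big_nil.
have -> : ('X - a%:P) * (('X - b%:P) * (('X - c%:P) * 1)) =
    'X^3 - (a + b + c) *: 'X^2 + (a * b + b * c + c * a) *: 'X - (a * b * c)%:P.
  by rewrite -!mul_polyC !(polyCD, polyCM); ring.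
move=> /polyP pE; have := pE 0; have := pE 1; have := pE 2.
rewrite !(coefD, coefN, coefZ, coefXn, coefX, coef1, coefC) /=.
rewrite !(mulr0, mulr1, subr0, sub0r, addr0, add0r, oppr0).
move=> /oppr_inj trE qE /oppr_inj rE.
by rewrite -trE -qE -rE.
Qed.
End Goldman.

(** * Hermitian spaces of signature (2, 1) *)

Section Herm.
Context {R : realType} {V : vectType R[i]}.
Variable h : {hermitian_sym V for Num.conj}.
Local Notation C := (R[i] : numClosedFieldType).
Implicit Types (x y p q v w : V) (a b c : R[i]).

Lemma hermJ x y : h x y = (h y x)^*.
Proof. by rewrite hermC expr0 mul1r. Qed.

Lemma herm_real x : (h x x)^* = h x x.
Proof. by rewrite -hermJ. Qed.

Lemma hermDl x y z : h (x + y) z = h x z + h y z. Proof. exact: linearDl. Qed.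
Lemma hermDr x y z : h z (x + y) = h z x + h z y. Proof. exact: linearDr. Qed.
Lemma hermBl x y z : h (x - y) z = h x z - h y z. Proof. exact: linearBl. Qed.
Lemma hermBr x y z : h z (x - y) = h z x - h z y. Proof. exact: linearBr. Qed.
Lemma hermZl a x z : h (a *: x) z = a * h x z. Proof. exact: linearZl_LR. Qed.
Lemma hermZr a x z : h z (a *: x) = a^* * h z x. Proof. exact: linearZr_LR. Qed.

Lemma orthonormal_basis : signature_ppm h -> exists e1 e2 e3 : V,
  [/\ forall x, exists a b c, x = a *: e1 + b *: e2 + c *: e3,
      [/\ h e1 e1 = 1, h e2 e2 = 1 & h e3 e3 = -1] &
      [/\ h e1 e2 = 0, h e1 e3 = 0 & h e2 e3 = 0]].
Proof.
move=> [e1 [e2 [e3 [eb [e12 e13 e23] [p1 p2 p3]]]]].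
have p3' : 0 < - h e3 e3 by rewrite oppr_gt0.
have nz (x : C) : 0 < x -> sqrtC x != 0 by move=> /gt_eqF x0; rewrite sqrtC_eq0 x0.
have unit_norm e (x : C) : 0 < x ->
  h ((sqrtC x)^-1 *: e) ((sqrtC x)^-1 *: e) = h e e / x.
  move=> x0; rewrite hermZl hermZr fmorphV /=.
  rewrite (conj_Creal (ger0_real _)) ?sqrtC_ge0 ?ltW// mulrA -invfM -expr2 sqrtCK.
  by rewrite mulrC.
exists ((sqrtC (h e1 e1))^-1 *: e1), ((sqrtC (h e2 e2))^-1 *: e2),
  ((sqrtC (- h e3 e3))^-1 *: e3); split.
- move=> x; have : x \in <<[:: e1; e2; e3]>>%VS by rewrite (span_basis eb) memvf.
  rewrite span_cons => /memv_addP[_ /vlineP[a ->] [w]].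
  rewrite span_cons => /memv_addP[_ /vlineP[b ->] [u]].
  rewrite span_seq1 => /vlineP[c ->] -> ->.
  exists (a * sqrtC (h e1 e1)), (b * sqrtC (h e2 e2)), (c * sqrtC (- h e3 e3)).
  by rewrite !scalerA !mulfK ?nz// addrA.
- by rewrite !unit_norm// !divff ?gt_eqF// invrN mulrN divff// lt_eqF.
- by rewrite !hermZl !hermZr e12 e13 e23 !mulr0.
Qed.

Lemma herm_coords e1 e2 e3 a b c a' b' c' :
  h e1 e1 = 1 -> h e2 e2 = 1 -> h e3 e3 = -1 ->
  h e1 e2 = 0 -> h e1 e3 = 0 -> h e2 e3 = 0 ->
  h (a *: e1 + b *: e2 + c *: e3) (a' *: e1 + b' *: e2 + c' *: e3) =
  a * a'^* + b * b'^* - c * c'^*.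
Proof.
move=> e11 e22 e33 e12 e13 e23.
rewrite !(hermDl, hermDr, hermZl, hermZr) e11 e22 e33 e12 e13 e23.
by rewrite (hermJ e2 e1) (hermJ e3 e1) (hermJ e3 e2) e12 e13 e23 rmorph0; ring.
Qed.

Lemma herm_real_num x : h x x \is Num.real.
Proof. by apply/CrealP; exact: herm_real. Qed.

(** In coordinates this is the reversed Cauchy-Schwarz inequality. *)
Lemma orth_neg_gt0 x y : signature_ppm h ->
  h x x < 0 -> h x y = 0 -> y != 0 -> 0 < h y y.
Proof.
move=> /orthonormal_basis[e1 [e2 [e3 [span [e11 e22 e33] [e12 e13 e23]]]]].
have formE a b c a' b' c' := herm_coords a b c a' b' c' e11 e22 e33 e12 e13 e23.
have [a [b [c ->]]] := span x; have [a' [b' [c' ->]]] := span y.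
rewrite !formE -!normCK subr_lt0 => xneg /eqP; rewrite subr_eq0 => /eqP xy y0.
rewrite subr_gt0.
have CS : `|c| ^+ 2 * `|c'| ^+ 2 <=
    (`|a| ^+ 2 + `|b| ^+ 2) * (`|a'| ^+ 2 + `|b'| ^+ 2).
  have xyJ : c^* * c' = a^* * a' + b^* * b'.
    by have := congr1 Num.conj xy; rewrite rmorphD !rmorphM /= !conjCK.
  rewrite -subr_ge0 (_ : _ - _ = `|a * b' - b * a'| ^+ 2) ?exprn_ge0//.
  transitivity ((`|a| ^+ 2 + `|b| ^+ 2) * (`|a'| ^+ 2 + `|b'| ^+ 2) -
      (a * a'^* + b * b'^*) * (a^* * a' + b^* * b')).
    by rewrite xy -xyJ !normCK; ring.
  by rewrite !normCK rmorphB !rmorphM /=; ring.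
have cpos : 0 < `|c| ^+ 2 by rewrite (le_lt_trans _ xneg)// addr_ge0 ?exprn_ge0.
have [N0|N0] := eqVneq (`|a'| ^+ 2 + `|b'| ^+ 2) 0; last first.
  rewrite -(ltr_pM2l cpos) (le_lt_trans CS)// ltr_pM2r// lt_def N0.
  by rewrite addr_ge0 ?exprn_ge0.
case/eqP: y0; move/eqP: N0; rewrite paddr_eq0 ?exprn_ge0// !expf_eq0 !normr_eq0 /=.
move=> /andP[/eqP a0 /eqP b0].
move/eqP: xy; rewrite a0 b0 rmorph0 !mulr0 addr0 eq_sym mulf_eq0 conjC_eq0.
have /negPf-> : c != 0 by apply: contraTneq cpos => ->; rewrite normr0 expr0n ltxx.
move=> /= /eqP->.
by rewrite !scale0r !addr0.
Qed.

Section Coordinates.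
Hypothesis dimV : \dim (fullv : {vspace V}) = 3%N.
Hypothesis sgnV : signature_ppm h.
Let e := vbasis (fullv : {vspace V}).
Let eb : basis_of fullv e := vbasisP _.
Local Notation mx g := (mxof e e g).

Definition gram : 'M[R[i]]_(\dim (fullv : {vspace V})) :=
  \matrix_(i, j) h e`_i e`_j.

Lemma herm_suml (I : finType) (F : I -> R[i]) (G : I -> V) y :
  h (\sum_i F i *: G i) y = \sum_i F i * h (G i) y.
Proof.
elim/big_ind2 : _ => [|x a x' a' <- <-|i _]; rewrite ?hermDl ?hermZl//.
by rewrite -(scale0r 0) hermZl mul0r.
Qed.

Lemma herm_sumr (I : finType) (F : I -> R[i]) (G : I -> V) y :
  h y (\sum_i F i *: G i) = \sum_i (F i)^* * h y (G i).
Proof.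
rewrite hermJ herm_suml rmorph_sum; apply: eq_bigr => i _.
by rewrite rmorphM /= -hermJ.
Qed.

Lemma herm_vecof (u v : 'rV_(\dim (fullv : {vspace V}))) : h (vecof e u) (vecof e v) =
  (u *m gram *m (map_mx Num.conj v)^T) 0 0.
Proof.
rewrite /vecof herm_sumr mxE; apply: eq_bigr => j _.
rewrite herm_suml !mxE mulrC; congr (_ * _).
by apply: eq_bigr => i _; rewrite mxE.
Qed.

Lemma herm_nondeg x : (forall y, h x y = 0) -> x = 0.
Proof.
have [e1 [e2 [e3 [span [e11 e22 e33] [e12 e13 e23]]]]] := orthonormal_basis sgnV.
have [a [b [c ->]]] := span x => x0.
have := x0 e1; have := x0 e2; have := x0 e3.
rewrite !(hermDl, hermZl) e11 e22 e33 e12 e13 e23 (hermJ e2 e1) (hermJ e3 e1).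
rewrite (hermJ e3 e2) e12 e13 e23 rmorph0 !mulr0 !addr0 !add0r !mulr1 mulrN1.
by move=> /eqP; rewrite oppr_eq0 => /eqP -> -> ->; rewrite !scale0r !addr0.
Qed.

Lemma gram_unit : gram \in unitmx.
Proof.
rewrite -row_free_unit; apply: inj_row_free => v vH.
apply/eqP; rewrite -(vecof_eq0 eb); apply/eqP/herm_nondeg => y.
by rewrite -(rVofK eb y) herm_vecof vH mul0mx mxE.
Qed.

Lemma gram_isometry (g : 'End(V)) : (forall x y, h (g x) (g y) = h x y) ->
  mx g *m gram *m (map_mx Num.conj (mx g))^T = gram.
Proof.
move=> gh; apply/matrixP => i j; rewrite [RHS]mxE -gh.
have rowE (k : 'I_(\dim (fullv : {vspace V}))) : g e`_k = vecof e (row k (mx g)).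
  by rewrite -vecof_delta (hom_vecof e eb) -rowE.
rewrite !rowE herm_vecof map_row !mxE; apply: eq_bigr => k _.
rewrite !mxE; congr (_ * _).
by apply: eq_bigr => l _; rewrite !mxE.
Qed.

Lemma leigenvalueP (g : 'End(V)) a :
  reflect (exists2 v, v != 0 & g v = a *: v) (leigenvalue g a).
Proof.
apply: (iffP idP) => [|[v v0 gv]].
  rewrite /leigenvalue => /negP h0.
  exists (vpick (leigenspace g a)); first by rewrite vpick0; apply/negP.
  have := memv_pick (leigenspace g a).
  by rewrite memv_ker add_lfunE opp_lfunE scale_lfunE id_lfunE subr_eq0 => /eqP.
apply: contraNneq v0 => g0; rewrite -memv0 -g0 memv_ker.
by rewrite add_lfunE opp_lfunE scale_lfunE id_lfunE gv subrr.
Qed.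

Lemma leigenvalue_root (g : 'End(V)) a : leigenvalue g a = root (char_poly (mx g)) a.
Proof.
by rewrite -eigenvalue_root_char /leigenvalue (leigenspaceE eb) (vsof_eq0 eb).
Qed.

Lemma char_poly_three_roots (g : 'End(V)) a b c : uniq [:: a; b; c] ->
  leigenvalue g a -> leigenvalue g b -> leigenvalue g c ->
  char_poly (mx g) = \prod_(x <- [:: a; b; c]) ('X - x%:P).
Proof.
rewrite !leigenvalue_root => abc ga gb gc.
rewrite [LHS](@all_roots_prod_XsubC _ _ [:: a; b; c]).
- by rewrite (monicP (char_poly_monic _)) scale1r.
- by rewrite size_char_poly [LHS](congr1 S dimV).
- by rewrite /= ga gb gc.
- by rewrite uniq_rootsE.
Qed.

(** An eigenvector v whose eigenvalue differs from that of the negative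
eigenvector x is orthogonal to x, hence positive; and an isometry scales a
nonisotropic eigenvector by a number of modulus 1. *)
Lemma eigenvalue_norm1 (g : 'End(V)) x v a b :
  (forall y z, h (g y) (g z) = h y z) -> h x x < 0 -> g x = a *: x ->
  v != 0 -> g v = b *: v -> `|b| = 1.
Proof.
move=> gh xneg gx v0 gv.
have norm1 (y : V) (d : C) : h y y != 0 -> g y = d *: y -> `|d| = 1.
  move=> hy gy; apply/eqP; rewrite -(@eqrXn2 _ 2)// expr1n normCK.
  by apply/eqP/(mulIf hy); rewrite mul1r -mulrA -hermZr -hermZl -gy gh.
have a1 : `|a| = 1 by apply: norm1 gx; rewrite lt_eqF.
have [xv|xv] := eqVneq (h x v) 0.
  by apply: norm1 gv; rewrite gt_eqF// (orth_neg_gt0 sgnV xneg).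
suff -> : b = a by [].
have abJ : a * b^* = 1.
  by apply: (mulIf xv); rewrite mul1r -mulrA -hermZr -hermZl -gx -gv gh.
have a0 : a != 0 by rewrite -normr_gt0 a1.
apply: (can_inj (@conjCK C)); apply: (mulfI a0).
by rewrite [LHS]abJ -normCK a1 expr1n.
Qed.

(** The eigenspaces are pairwise orthogonal and span V; if no eigenvector were
negative, the form would be positive semidefinite. *)
Lemma neg_eigenvector (g : 'End(V)) (a_ : 'I_3 -> R[i]) :
  (forall y z, h (g y) (g z) = h y z) -> injective a_ ->
  (forall i, `|a_ i| = 1) -> (forall i, leigenvalue g (a_ i)) ->
  exists x i, h x x < 0 /\ g x = a_ i *: x.
Proof.
move=> gh a_inj a1 ga.
have [e1 [e2 [e3 [_ [_ _ e33] _]]]] := orthonormal_basis sgnV.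
pose S := (\sum_(i < 3) eigenspace (mx g) (a_ i))%MS.
have Sdirect : mxdirect (\sum_(i < 3) eigenspace (mx g) (a_ i))%MS.
  by apply: mxdirect_sum_eigenspace => i j _ _; exact: a_inj.
have Sfull : row_full S.
  rewrite /row_full eqn_leq rank_leq_col /S (mxdirectP Sdirect) /=.
  rewrite [X in (X <= _)%N]dimV -[X in (X <= _)%N](card_ord 3) -sum1_card.
  apply: leq_sum => i _; rewrite lt0n mxrank_eq0.
  by have := ga i; rewrite leigenvalue_root -eigenvalue_root_char.
have /sub_sumsmxP[u uE] : (rVof e e3 <= S)%MS by exact: submx_full.
pose v i := vecof e (u i *m eigenspace (mx g) (a_ i)).
have gv i : g (v i) = a_ i *: v i.
  rewrite /v (hom_vecof e eb).
  have /eigenspaceP -> :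
      (u i *m eigenspace (mx g) (a_ i) <= eigenspace (mx g) (a_ i))%MS.
    exact: submxMl.
  by rewrite linearZ.
have vE : e3 = \sum_i v i by rewrite -(rVofK eb e3) uE linear_sum.
move: v gv vE => v gv vE {uE S Sfull Sdirect u}.
have vv i j : i != j -> h (v i) (v j) = 0.
  move=> ij; have := gh (v i) (v j).
  rewrite (gv i) (gv j) hermZl hermZr (conj_unit (a1 j)) mulrA => /eqP.
  rewrite -subr_eq0 -{2}[h _ _]mul1r -mulrBl mulf_eq0 subr_eq0 => /orP[|/eqP//].
  have aj0 : a_ j != 0 by rewrite -normr_gt0 a1.
  by rewrite -(inj_eq (mulIf aj0)) mulfVK// mul1r (inj_eq a_inj) (negPf ij).
have [i vi|hv] := pickP (fun i => h (v i) (v i) < 0); first by exists (v i), i.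
have : 0 <= h e3 e3.
  rewrite vE -(eq_bigr _ (fun i _ => scale1r (v i))) herm_suml sumr_ge0// => i _.
  rewrite mul1r herm_sumr (bigD1 i)//= big1 => [|j ji]; last first.
    by rewrite vv ?mulr0// eq_sym.
  rewrite rmorph1 mul1r addr0.
  by have /negbT := hv i; rewrite -real_leNgt// herm_real_num.
by rewrite e33 oppr_ge0 ler10.
Qed.

Lemma SU_lift_self (g : 'End(V)) : in_SU h g -> SU_lift h g g.
Proof. by move=> gSU; split=> //; exists 1; rewrite ?oner_eq0// scale1r. Qed.

(** Goldman's classification of the regular elliptic isometries by their trace. *)
Lemma regular_ellipticP (g : 'End(V)) : in_SU h g ->
  regular_elliptic h g <-> goldman (\tr (mx g) : C) < 0.
Proof.
move=> gSU; have [gh gdet] := gSU; have gH := gram_isometry gh; split.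
  move=> [[x [x0 xneg] [d gx]] /(_ _ (SU_lift_self gSU))].
  move=> [a [b [c [abc ga gb gc]]]].
  have := char_poly_three_roots abc ga gb gc.
  move=> /(isometry_eigenvalues dimV gram_unit gH gdet) [abc1 <- qE].
  have unit_eig (y : R[i]) : leigenvalue g y -> `|y| = 1.
    by case/leigenvalueP => v v0 gv; exact: eigenvalue_norm1 gx v0 gv.
  by apply: goldman_lt0 => //; exact: unit_eig.
move=> gneg; have [r] := closed_field_poly_normal (char_poly (mx g)).
rewrite (monicP (char_poly_monic _)) scale1r => pE.
have : size r = 3.
  have := congr1 (fun p : {poly _} => size p) pE.
  by rewrite size_char_poly size_prod_XsubC [in LHS]dimV => -[].
case: r pE => [|a [|b [|c []]]]// pE _.
have [abc trE qE] := isometry_eigenvalues dimV gram_unit gH gdet pE.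
rewrite -trE in gneg.
have a1 := goldman_lt0_unit abc qE gneg.
have sE : a + b + c = b + c + a by ring.
have sE' : a + b + c = c + a + b by ring.
have b1 : `|b| = 1.
  by apply: (@goldman_lt0_unit _ b c a); rewrite -?sE// -?abc ?qE; ring.
have c1 : `|c| = 1.
  by apply: (@goldman_lt0_unit _ c a b); rewrite -?sE'// -?abc ?qE; ring.
have uniq_abc : uniq [:: a; b; c].
  have : (a - b) * (b - c) * (c - a) != 0.
    by apply: contraTneq gneg => w0; rewrite goldman_vandermonde// w0 expr0n ltxx.
  rewrite !mulf_eq0 !subr_eq0 !negb_or => /andP[/andP[ab bc] ca].
  by rewrite /= !inE negb_or ab bc (eq_sym a) ca.
have ga (y : R[i]) : y \in [:: a; b; c] -> leigenvalue g y.
  by move=> yabc; rewrite leigenvalue_root pE root_prod_XsubC.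
pose a_ (i : 'I_3) := [:: a; b; c]`_i.
have a_in i : a_ i \in [:: a; b; c] by rewrite mem_nth.
split.
  have [|i|i|x [i [xneg gx]]] := @neg_eigenvector g a_ gh.
  - by move=> i j /eqP; rewrite nth_uniq// => /eqP/val_inj.
  - by have := a_in i; rewrite !inE => /or3P[]/eqP->.
  - exact: ga.
  exists x; last by exists (a_ i).
  split=> //; apply: contraTneq xneg => ->.
  by rewrite -(scale0r 0) hermZl mul0r ltxx.
move=> l [_ [k k0 ->]].
have kg (y : R[i]) : y \in [:: a; b; c] -> leigenvalue (k *: g) (k * y).
  move=> /ga/leigenvalueP[v v0 gv].
  by apply/leigenvalueP; exists v; rewrite // scale_lfunE gv scalerA.
exists (k * a), (k * b), (k * c).
split; try by apply: kg; rewrite !inE eqxx ?orbT.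
by move: uniq_abc; rewrite /= !inE !(inj_eq (mulfI k0)).
Qed.

End Coordinates.
End Herm.

(** * Products of reflections *)

(** Weinstein-Aronszajn identity: both sides are determinants of the products, in
the two orders, of the same two block matrices. *)
Lemma det_1B_mulmx (K : comNzRingType) m n (A : 'M[K]_(m, n)) (B : 'M[K]_(n, m)) :
  \det (1%:M - A *m B) = \det (1%:M - B *m A).
Proof.
have : \det (block_mx 1%:M A B 1%:M *m block_mx 1%:M 0 (- B) 1%:M) =
       \det (block_mx 1%:M 0 (- B) 1%:M *m block_mx 1%:M A B 1%:M).
  by rewrite !det_mulmx mulrC.
rewrite !mulmx_block !(mul1mx, mulmx1, mul0mx, mulmx0, add0r, addr0, mulmxN, mulNmx).
by rewrite addrN addNr !det_ublock !det1 mulr1 mul1r [- _ + _]addrC.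
Qed.

(** If P is the matrix of the orthogonal projection onto a line, this is the
matrix of the reflection with this line as polar point. *)
Definition proj_involution (K : comNzRingType) n (P : 'M[K]_n) : 'M[K]_n :=
  2 *: P - 1%:M.

Lemma mxtrace_involution2 (K : comNzRingType) n (P Q : 'M[K]_n) :
  \tr (proj_involution P *m proj_involution Q) =
  4 * \tr (P *m Q) - 2 * \tr P - 2 * \tr Q + \tr (1%:M : 'M[K]_n).
Proof.
rewrite /proj_involution mulmxBr mulmx1 mulmxBl mul1mx -scalemxAl -scalemxAr.
by rewrite !(raddfB (@mxtrace K n)) /= !mxtraceZ; ring.
Qed.

Lemma mxtrace_involution3 (K : comNzRingType) n (P Q S : 'M[K]_n) :
  \tr (proj_involution P *m (proj_involution Q *m proj_involution S)) =
  8 * \tr (P *m Q *m S) - 4 * (\tr (P *m Q) + \tr (P *m S) + \tr (Q *m S))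
  + 2 * (\tr P + \tr Q + \tr S) - \tr (1%:M : 'M[K]_n).
Proof.
rewrite /proj_involution mulmxA mulmxBr mulmx1 mulmxBr mulmx1.
rewrite !mulmxBl !mul1mx -!scalemxAl.
rewrite -!scalemxAr -!scalemxAl.
by rewrite !(raddfB (@mxtrace K n)) /= !mxtraceZ; ring.
Qed.

Section Reflections.
Context {R : realType} {V : vectType R[i]}.
Variable h : {hermitian_sym V for Num.conj}.
Local Notation C := (R[i] : numClosedFieldType).
Implicit Types (x y p q v w : V) (a b c : R[i]).

Lemma reflectionE p x : reflection h p x = (2 * (h x p / h p p)) *: p - x.
Proof. by rewrite lfunE. Qed.

Lemma reflection_isometry p x y : h p p != 0 ->
  h (reflection h p x) (reflection h p y) = h x y.
Proof.
move=> p0; rewrite !reflectionE !(hermBl, hermBr, hermZl, hermZr) !rmorphM /=.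
rewrite fmorphV /= herm_real rmorph_nat -(hermJ h p y).
by field.
Qed.

Lemma reflectionK p x : h p p != 0 -> reflection h p (reflection h p x) = x.
Proof.
move=> p0; rewrite !reflectionE !(hermBl, hermZl) opprB addrCA -scalerBl.
by rewrite [X in X *: p](_ : _ = 0) ?scale0r ?addr0//; field.
Qed.

Lemma reflection_conj p q : h p p != 0 ->
  (reflection h p \o reflection h q \o reflection h p)%VF =
  reflection h (reflection h p q).
Proof.
move=> p0; apply/lfunP => x; rewrite !comp_lfunE [RHS]reflectionE.
rewrite reflection_isometry// [X in reflection h p X]reflectionE.
rewrite linearB linearZ /= reflectionK//; congr (_ *: _ - _).
by rewrite -{2}(reflectionK x p0) reflection_isometry.
Qed.

Section Coordinates.
Hypothesis dimV : \dim (fullv : {vspace V}) = 3%N.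
Let e := vbasis (fullv : {vspace V}).
Let eb : basis_of fullv e := vbasisP _.
Local Notation mx g := (mxof e e g).

(** Matrices act on row vectors, so that this column represents the linear form
[h^~ p]. *)
Definition herm_col p : 'cV[R[i]]_(\dim (fullv : {vspace V})) :=
  \col_i h e`_i p.

Lemma mul_herm_col x p : rVof e x *m herm_col p = (h x p)%:M.
Proof.
rewrite [LHS]mx11_scalar; congr (_%:M).
rewrite -{2}(rVofK eb x) /vecof herm_suml mxE.
by apply: eq_bigr => i _; rewrite !mxE.
Qed.

Definition proj_mx p := (h p p)^-1 *: (herm_col p *m rVof e p).

Lemma mx_reflection p : mx (reflection h p) = proj_involution (proj_mx p).
Proof.
rewrite /proj_involution.
apply/row_matrixP => i; rewrite !rowE.
rewrite (mul_mxof e e) mulmxBr -scalemxAr mulmx1 reflectionE.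
rewrite linearB linearZ /= (vecofK eb); congr (_ - _).
rewrite /proj_mx -scalemxAr mulmxA.
rewrite -{2}(vecofK eb (delta_mx 0 i)) mul_herm_col mul_scalar_mx !scalerA.
by congr (_ *: _); rewrite mulrA mulrAC.
Qed.

Lemma proj_mxM p q : proj_mx p *m proj_mx q =
  (h p q / (h p p * h q q)) *: (herm_col p *m rVof e q).
Proof.
rewrite /proj_mx -scalemxAl -scalemxAr scalerA mulmxA -(mulmxA (herm_col p)).
rewrite mul_herm_col mul_mx_scalar -scalemxAl scalerA; congr (_ *: _).
by rewrite invfM; ring.
Qed.

Lemma tr_herm_col p q : \tr (herm_col p *m rVof e q) = h q p.
Proof. by rewrite mxtrace_mulC mul_herm_col mxtrace_scalar. Qed.

Lemma tr_proj_mx p : h p p != 0 -> \tr (proj_mx p) = 1.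
Proof. by move=> p0; rewrite mxtraceZ tr_herm_col mulVf. Qed.

Lemma tr_proj_mx2 p q : \tr (proj_mx p *m proj_mx q) = tance h p q.
Proof. by rewrite proj_mxM mxtraceZ tr_herm_col mulrAC. Qed.

Lemma tr_proj_mx3 p q r : \tr (proj_mx p *m proj_mx q *m proj_mx r) =
  varkappa h p q r.
Proof.
rewrite proj_mxM /proj_mx -scalemxAl -scalemxAr scalerA mulmxA -(mulmxA (herm_col p)).
rewrite mul_herm_col mul_mx_scalar -scalemxAl !mxtraceZ tr_herm_col /varkappa.
by rewrite !invfM; ring.
Qed.

Lemma tr_1mx : \tr (1%:M : 'M[R[i]]_(\dim (fullv : {vspace V}))) = 3.
Proof. by rewrite mxtrace1 dimV. Qed.

Lemma tr_reflection2 p q : h p p != 0 -> h q q != 0 ->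
  \tr (mx (reflection h p \o reflection h q)%VF) = 4 * tance h p q - 1.
Proof.
move=> p0 q0.
rewrite (mxof_comp e e eb) !mx_reflection mxtrace_involution2.
have := (tr_proj_mx2 q p, tr_proj_mx p0, tr_proj_mx q0, tr_1mx).
move: (proj_mx q) (proj_mx p) => P2 P1 [[[-> ->] ->] ->]; rewrite /tance.
by rewrite [h q p * _]mulrC [h q q * _]mulrC; ring.
Qed.

Lemma tr_reflection3 p q r : h p p != 0 -> h q q != 0 -> h r r != 0 ->
  \tr (mx (reflection h p \o reflection h q \o reflection h r)%VF) =
  8 * varkappa h r q p - 4 * (tance h p q + tance h q r + tance h r p) + 3.
Proof.
move=> p0 q0 r0; rewrite !(mxof_comp e e eb) !mx_reflection.
have tC x y : tance h x y = tance h y x.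
  by rewrite /tance [h y x * _]mulrC [h y y * _]mulrC.
rewrite mxtrace_involution3.
have := (tr_proj_mx3 r q p, tr_proj_mx2 r q, tr_proj_mx2 r p, tr_proj_mx2 q p).
have := (tr_proj_mx p0, tr_proj_mx q0, tr_proj_mx r0, tr_1mx).
move: (proj_mx r) (proj_mx q) (proj_mx p) => P3 P2 P1.
move=> [[[-> -> ->] ->]] [[[-> ->] ->] ->].
by rewrite (tC q p) (tC r q); ring.
Qed.

Lemma det_reflection p : h p p != 0 -> lfun_det (reflection h p) = 1.
Proof.
move=> p0; rewrite /lfun_det mx_reflection /proj_involution -opprB -scaleN1r.
rewrite detZ [X in _ ^+ X]dimV.
rewrite /proj_mx scalerA scalemxAl det_1B_mulmx -scalemxAr mul_herm_col.
rewrite scale_scalar_mx -raddfB /= det_scalar1.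
by field.
Qed.

Lemma lfun_det_comp (f g : 'End(V)) : lfun_det (f \o g)%VF = lfun_det f * lfun_det g.
Proof. by rewrite /lfun_det (mxof_comp e e eb) det_mulmx mulrC. Qed.

Lemma SU_comp (f g : 'End(V)) : in_SU h f -> in_SU h g -> in_SU h (f \o g)%VF.
Proof.
move=> [fh fd] [gh gd]; split; last by rewrite lfun_det_comp fd gd mulr1.
by move=> x y; rewrite !comp_lfunE fh gh.
Qed.

Lemma SU_reflection p : h p p != 0 -> in_SU h (reflection h p).
Proof.
move=> p0; split; last exact: det_reflection.
by move=> x y; exact: reflection_isometry.
Qed.

Lemma SU_word_A p q r : h p p != 0 -> h q q != 0 -> h r r != 0 ->
  in_SU h (word_A h p q r).
Proof. by move=> p0 q0 r0; do !apply: SU_comp; exact: SU_reflection. Qed.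

Lemma SU_word_B p q r : h p p != 0 -> h q q != 0 -> h r r != 0 ->
  in_SU h (word_B h p q r).
Proof. by move=> p0 q0 r0; do !apply: SU_comp; exact: SU_reflection. Qed.

(** The middle factors I_2 I_1 I_2 form the reflection with polar point I_2 p_1. *)
Lemma tr_word_A p q r : h p p != 0 -> h q q != 0 -> h r r != 0 ->
  \tr (mx (word_A h p q r)) = 4 * tance h r (reflection h q p) - 1.
Proof.
move=> p0 q0 r0; rewrite /word_A -!comp_lfunA (comp_lfunA (reflection h q)).
by rewrite reflection_conj// tr_reflection2// reflection_isometry.
Qed.

End Coordinates.
End Reflections.

(** * The two words on a triangle *)

Section ComplexReal.
Context {R : realType}.
Local Open Scope complex_scope.

Lemma conj_real (x : R) : (x%:C : R[i])^*%R = x%:C.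
Proof. by rewrite -[LHS]/(conjc _) conjc_real. Qed.

Lemma addJ_Re (z : R[i]) : z + z^*%R = (2 * complex.Re z)%:C.
Proof. by rewrite -[z^*%R]/(conjc z) addcJ rmorphM rmorph_nat. Qed.

Lemma conj_8conjD (z : R[i]) (c : R) : (8 * z^*%R + c%:C)^*%R = 8 * z + c%:C.
Proof. by rewrite rmorphD rmorphM /= conjCK conj_real rmorph_nat. Qed.

(** Goldman's discriminant depends only on 2 Re z and |z|^2. *)
Lemma goldman_sumprod (z : R[i]) (s p : R) : z + z^*%R = s%:C -> z * z^*%R = p%:C ->
  goldman (z : (R[i] : numClosedFieldType)) =
  (p ^+ 2 - 4 * (s ^+ 3 - 3 * s * p) + 18 * p - 27)%:C.
Proof.
move=> sE pE.
transitivity (p%:C ^+ 2 - 4 * (s%:C ^+ 3 - 3 * s%:C * p%:C) + 18 * p%:C - 27 : R[i]).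
  by rewrite -sE -pE /goldman; ring.
by ring.
Qed.

(** Here u stands for m t, and p and q are |tr W_B|^2 and 2 Re (tr W_B). *)
Lemma goldman_disc_B (a b c u : R) :
  let s := a + b + c in
  let p := (3 - 4 * s) ^+ 2 + 64 * (a * b * c) + 16 * (3 - 4 * s) * u in
  let q := 6 - 8 * s + 16 * u in
  p ^+ 2 - 4 * (q ^+ 3 - 3 * q * p) + 18 * p - 27 =
  disc_B (2 * (1 - a)) (2 * (1 - b)) (2 * (1 - c)) (9 - 8 * s + 16 * u).
Proof. by rewrite /disc_B /disc_const /disc_slope /=; ring. Qed.
End ComplexReal.

Section Triangle.
Local Open Scope complex_scope.
Context {R : realType} {V : vectType R[i]}.
Variable h : {hermitian_sym V for Num.conj}.
Hypothesis dimV : \dim (fullv : {vspace V}) = 3%N.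
Hypothesis sgnV : signature_ppm h.
Local Notation r_ n := (@r_ R n).
Local Notation d_ n := (@cosine_defect R n).

Variables (n1 n2 n3 : nat) (p1 p2 p3 : V) (t : R).
Hypotheses (n1_ge4 : (3 < n1)%N) (n2_ge4 : (3 < n2)%N) (n3_ge4 : (3 < n3)%N).
Hypothesis tri : triangle h n1 n2 n3 p1 p2 p3.
Hypothesis param : triangle_param h p1 p2 p3 = t.

Let nz1 : h p1 p1 != 0. Proof. by case: tri => -[/lt0r_neq0]. Qed.
Let nz2 : h p2 p2 != 0. Proof. by case: tri => -[_ /lt0r_neq0]. Qed.
Let nz3 : h p3 p3 != 0. Proof. by case: tri => -[_ _ /lt0r_neq0]. Qed.
Let ta12 : tance h p1 p2 = (r_ n1 ^+ 2)%:C.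
Proof. by case: tri => _ [[_ [_ _ <-]]]. Qed.
Let ta23 : tance h p2 p3 = (r_ n2 ^+ 2)%:C.
Proof. by case: tri => _ [_ [_ [_ _ <-]]]. Qed.
Let ta31 : tance h p3 p1 = (r_ n3 ^+ 2)%:C.
Proof. by case: tri => _ [_ _ [_ [_ _ <-]]]. Qed.
Let k := varkappa h p1 p2 p3.
Let m := r_ n1 * r_ n2 * r_ n3.

Let m_gt0 : 0 < m.
Proof. by rewrite !mulr_gt0// r_gt0// ltnW. Qed.

Let kJ : k^*%R = varkappa h p3 p2 p1.
Proof.
rewrite /k /varkappa !rmorphM fmorphV !rmorphM /= !herm_real.
by rewrite -(hermJ h p2 p1) -(hermJ h p3 p2) -(hermJ h p1 p3) !invfM; ring.
Qed.

Let k_norm2 : k * k^*%R = (m ^+ 2)%:C.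
Proof.
transitivity (tance h p1 p2 * tance h p2 p3 * tance h p3 p1).
  by rewrite kJ /k /varkappa /tance !invfM; ring.
by rewrite ta12 ta23 ta31 /m; ring.
Qed.

Let k_norm : `|k| = m%:C.
Proof.
apply/eqP; rewrite -(@eqrXn2 _ 2)// ?lecR ?(ltW m_gt0)//.
by rewrite normCK k_norm2 rmorphXn.
Qed.

Let k_re : k + k^*%R = (2 * (m * t))%:C.
Proof.
rewrite addJ_Re; congr (_%:C); rewrite -param /triangle_param -/k k_norm.
rewrite -(fmorphV (real_complex R)); case: k => x y /=.
by rewrite mulr0 subr0; field; rewrite gt_eqF.
Qed.

Lemma triangle_param_bound : -1 <= t <= 1.
Proof.
rewrite -ler_norml -lecR -[X in _ <= X](_ : `|k / `|k| | = 1%:C).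
  by rewrite -param; exact: normc_ge_Re.
by rewrite normrM normfV normr_id divff// k_norm eq_complex /= gt_eqF.
Qed.

Let s := r_ n1 ^+ 2 + r_ n2 ^+ 2 + r_ n3 ^+ 2.

Lemma word_B_ellipticP : regular_elliptic h (word_B h p1 p2 p3) <->
  disc_B (d_ n1) (d_ n2) (d_ n3) (9 - 8 * s + 16 * (m * t)) < 0.
Proof.
have trE := tr_reflection3 dimV nz1 nz2 nz3.
rewrite -kJ ta12 ta23 ta31 -!rmorphD -/s in trE.
have trE' : \tr (mxof (vbasis fullv) (vbasis fullv) (word_B h p1 p2 p3)) =
  8 * k^*%R + (3 - 4 * s)%:C.
  by rewrite [LHS]trE; ring.
have := regular_ellipticP dimV sgnV (SU_word_B dimV nz1 nz2 nz3).
rewrite trE' (@goldman_sumprod _ _ (6 - 8 * s + 16 * (m * t))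
  ((3 - 4 * s) ^+ 2 + 64 * (r_ n1 ^+ 2 * r_ n2 ^+ 2 * r_ n3 ^+ 2)
    + 16 * (3 - 4 * s) * (m * t))).
- by rewrite goldman_disc_B ltcR.
- transitivity (8 * (k + k^*%R) + 2 * (3 - 4 * s)%:C : R[i]).
    by rewrite conj_8conjD; ring.
  by rewrite k_re; ring.
transitivity (64 * (k * k^*%R) + 8 * (3 - 4 * s)%:C * (k + k^*%R)
    + (3 - 4 * s)%:C ^+ 2 : R[i]).
  by rewrite conj_8conjD; ring.
by rewrite k_re k_norm2 /m; ring.
Qed.

Let ta_A : tance h p3 (reflection h p2 p1) =
  (4 * (r_ n1 ^+ 2 * r_ n2 ^+ 2) + r_ n3 ^+ 2 - 4 * (m * t))%:C.
Proof.
have -> : tance h p3 (reflection h p2 p1) =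
  4 * (tance h p1 p2 * tance h p2 p3) + tance h p3 p1 - 2 * (k + k^*%R).
  rewrite kJ /k /varkappa /tance reflection_isometry//.
  rewrite !reflectionE !(hermBl, hermBr, hermZl, hermZr) !rmorphM /= fmorphV /=.
  rewrite rmorph_nat herm_real -(hermJ h p2 p1).
  by field; rewrite nz1 nz2 nz3.
by rewrite ta12 ta23 ta31 k_re; ring.
Qed.

Lemma word_A_ellipticP : regular_elliptic h (word_A h p1 p2 p3) <->
  threshold_A (d_ n1) (d_ n2) (d_ n3) < 9 - 8 * s + 16 * (m * t).
Proof.
have := regular_ellipticP dimV sgnV (SU_word_A dimV nz1 nz2 nz3).
rewrite (tr_word_A dimV nz1 nz2 nz3) ta_A.
set T := 4 * _ + _ - _.
have -> : (4 * T%:C - 1 : R[i]) = (4 * T - 1)%:C.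
  by ring.
rewrite (@goldman_sumprod _ _ (2 * (4 * T - 1)) ((4 * T - 1) ^+ 2)); last first.
- by rewrite conj_real; ring.
- by rewrite conj_real; ring.
rewrite ltcR.
(* For real z the discriminant is (z - 3)^3 (z + 1). *)
have -> : ((4 * T - 1) ^+ 2) ^+ 2 - 4 * ((2 * (4 * T - 1)) ^+ 3 -
    3 * (2 * (4 * T - 1)) * (4 * T - 1) ^+ 2) + 18 * (4 * T - 1) ^+ 2 - 27 =
  256 * T * (T - 1) ^+ 2 * (T - 1) by ring.
(* T >= (2 r_1 r_2 - r_3)^2, and 2 r_1 r_2 >= 1 > r_3. *)
have T0 : 0 < T.
  have r4_gt0 : 0 <= r_ 4 by exact/ltW/r_gt0.
  have r12 : 1 / 2 <= r_ n1 * r_ n2.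
    by rewrite -r4_sq expr2 ler_pM// r_le.
  have r3 : r_ n3 < 1 by rewrite r_lt1// ltnW// ltnW.
  have mt : m * t <= m.
    by have /andP[_ t1] := triangle_param_bound; rewrite ger_pMr.
  have : 0 < (2 * (r_ n1 * r_ n2) - r_ n3) ^+ 2.
    rewrite exprn_gt0// subr_gt0 (lt_le_trans r3)//.
    by move: (r_ n1 * r_ n2) r12 => q; lra.
  suff -> : (2 * (r_ n1 * r_ n2) - r_ n3) ^+ 2 = T + 4 * (m * t) - 4 * m.
    move=> T0; have -> : T = (T + 4 * (m * t) - 4 * m) + 4 * (m - m * t) by ring.
    by rewrite ltr_wpDr// mulr_ge0// subr_ge0.
  by rewrite /T /m; ring.
have <- : (T < 1) = (256 * T * (T - 1) ^+ 2 * (T - 1) < 0).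
  have [->|T1] := eqVneq T 1; first by rewrite subrr mulr0 !ltxx.
  have T2 : 0 < 256 * T * (T - 1) ^+ 2.
    apply: mulr_gt0; first exact: mulr_gt0.
    by rewrite lt_def sqrf_eq0 subr_eq0 T1 sqr_ge0.
  by rewrite (pmulr_rlt0 _ T2) subr_lt0.
have -> : (threshold_A (d_ n1) (d_ n2) (d_ n3) < 9 - 8 * s + 16 * (m * t)) = (T < 1).
  rewrite -subr_gt0 -[RHS]subr_gt0 -[RHS](@pmulr_rgt0 _ 4)//; congr (_ < _).
  by rewrite /T /threshold_A /cosine_defect /s; ring.
by [].
Qed.

End Triangle.

(** * Existence of triangles *)

Section Existence.
Local Open Scope complex_scope.
Context {R : realType} {V : vectType R[i]}.
Variable h : {hermitian_sym V for Num.conj}.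
Hypothesis sgnV : signature_ppm h.
Local Notation r_ n := (@r_ R n).

(** The two polar points span a positive definite plane; a negative vector remains
negative when its projection onto this plane is subtracted. *)
Lemma geodesics_meet (p q : V) : h p p = 1 -> h q q = 1 ->
  `|h p q| ^+ 2 < 1 -> exists x, [/\ x != 0, h x p = 0, h x q = 0 & h x x < 0].
Proof.
move=> hp hq pq1; have [e1 [e2 [e [_ [_ _ ee] _]]]] := orthonormal_basis sgnV.
set u := h p q in pq1; set d : R[i] := 1 - `|u| ^+ 2.
have d0 : 0 < d by rewrite subr_gt0.
have qpE : h q p = u^*%R by rewrite (hermJ h q p).
have dE : d = 1 - u * u^*%R by rewrite /d normCK.
set a := h e p; set b := h e q.
have dnz : 1 - u * u^*%R != 0 by rewrite -dE gt_eqF.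
pose x := e - ((a - b * u^*%R) / d) *: p - ((b - a * u) / d) *: q.
have xp : h x p = 0.
  by rewrite /x !hermBl !hermZl hp qpE -/a dE; field.
have xq : h x q = 0.
  by rewrite /x !hermBl !hermZl hq -/u -/b dE; field.
have xx : h x x = - (1 + (`|a - b * u^*%R| ^+ 2 + d * `|b| ^+ 2) / d).
  rewrite {2}/x !hermBr !hermZr xp xq !mulr0 !subr0 /x !hermBl !hermZl ee.
  rewrite (hermJ h p e) (hermJ h q e) -/a -/b !normCK rmorphB rmorphM /= conjCK dE.
  by field.
have xneg : h x x < 0.
  rewrite xx oppr_lt0 ltr_wpDr// divr_ge0 ?(ltW d0)//.
  by rewrite addr_ge0 ?mulr_ge0 ?exprn_ge0 ?(ltW d0).
exists x; split=> //; apply: contraTneq xneg => ->.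
by rewrite -(scale0r 0) hermZl mul0r ltxx.
Qed.

Lemma meet_at_angle_unit n (p q : V) : (3 < n)%N -> h p p = 1 -> h q q = 1 ->
  h p q * h q p = (r_ n ^+ 2)%:C -> meet_at_angle h p q (pi / n%:R).
Proof.
move=> n3 hp hq pq.
have n2 : (2 < n)%N by exact: ltnW.
have r1 : r_ n ^+ 2 < 1 by rewrite expr_lt1 ?r_lt1 ?ltW ?r_gt0// ltnW.
have pqn : `|h p q| ^+ 2 < 1 by rewrite normCK -hermJ pq -[1]/(1%:C) ltcR.
split.
  have [x [x0 xp xq xneg]] := geodesics_meet hp hq pqn.
  by exists x; split; split=> //; split=> //; exact: ltW.
have /andP[n_gt0 n_le] := @pi_div_itv R n (ltnW n2).
rewrite /is_angle /tance hp hq mulr1 divr1 pq; split=> //.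
- by rewrite -[1]/(1%:C) lecR ltW.
- by rewrite ltW.
Qed.

(** The Gram matrix with off-diagonal entries r_1, r_2 and r_3 eps, where eps has
modulus 1 and real part t, has determinant
1 - r_1^2 - r_2^2 - r_3^2 + 2 r_1 r_2 r_3 t. It is realized by the Cholesky
algorithm in an orthonormal basis: the bound on t says that the last diagonal
coefficient is the root of a positive number. *)
Lemma triangle_exists n1 n2 n3 t : (3 < n1)%N -> (3 < n2)%N -> (3 < n3)%N ->
  -1 <= t <= 1 ->
  2 * (r_ n1 * r_ n2 * r_ n3 * t) < r_ n1 ^+ 2 + r_ n2 ^+ 2 + r_ n3 ^+ 2 - 1 ->
  exists p1 p2 p3 : V,
    triangle h n1 n2 n3 p1 p2 p3 /\ triangle_param h p1 p2 p3 = t.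
Proof.
move=> n1_ge4 n2_ge4 n3_ge4 t1 tM.
have [e1 [e2 [e3 [span [e11 e22 e33] [e12 e13 e23]]]]] := orthonormal_basis sgnV.
have formE a b c a' b' c' := herm_coords a b c a' b' c' e11 e22 e33 e12 e13 e23.
have rgt0 n : (3 < n)%N -> 0 < r_ n by move=> n4; rewrite r_gt0// ltnW.
have r10 := rgt0 _ n1_ge4; have r20 := rgt0 _ n2_ge4; have r30 := rgt0 _ n3_ge4.
have a1 : r_ n1 ^+ 2 < 1.
  by rewrite expr_lt1 ?r_lt1 ?ltW// ltnW// ltnW.
set a := r_ n1 in r10 a1 tM *; set b := r_ n2 in r20 tM *.
set c := r_ n3 in r30 tM *.
have d0 : 0 < 1 - a ^+ 2 by rewrite subr_gt0.
pose d := Num.sqrt (1 - a ^+ 2).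
have dE : d ^+ 2 = 1 - a ^+ 2 by rewrite sqr_sqrtr// ltW.
have dnz : d%:C != 0 :> R[i] by rewrite eq_complex /= eqxx andbT gt_eqF// sqrtr_gt0.
pose f2 := (a ^+ 2 + b ^+ 2 + c ^+ 2 - 1 - 2 * (a * b * c * t)) / (1 - a ^+ 2).
have f20 : 0 < f2 by rewrite divr_gt0// subr_gt0.
pose f := Num.sqrt f2.
have fE : f ^+ 2 = f2 by rewrite sqr_sqrtr// ltW.
have fnz : f%:C != 0 :> R[i] by rewrite eq_complex /= eqxx andbT gt_eqF// sqrtr_gt0.
pose eps : R[i] := t +i* Num.sqrt (1 - t ^+ 2).
have t2 : 0 <= 1 - t ^+ 2.
  have /andP[t1l t1r] := t1.
  by rewrite (_ : 1 - t ^+ 2 = (1 - t) * (1 + t)); [rewrite mulr_ge0//; lra | ring].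
have eps_norm : eps * eps^*%R = 1.
  apply/eqP; rewrite eq_complex /=; apply/andP; split; apply/eqP; last by ring.
  by rewrite mulrN opprK -(expr2 (Num.sqrt _)) sqr_sqrtr//; ring.
have eps_re : eps + eps^*%R = (2 * t)%:C by rewrite addJ_Re.
pose g : R[i] := (b%:C - a%:C * (c%:C * eps)) / d%:C.
pose p1 := e1.
pose p2 := a%:C *: e1 + d%:C *: e2 + 0 *: e3.
pose p3 := (c%:C * eps) *: e1 + g *: e2 + f%:C *: e3.
have p1E : p1 = 1 *: e1 + 0 *: e2 + 0 *: e3.
  by rewrite scale1r !scale0r !addr0.
have dC : d%:C ^+ 2 = 1 - a%:C ^+ 2 :> R[i].
  by transitivity ((d ^+ 2)%:C : R[i]); [ring | rewrite dE; ring].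
have h11 : h p1 p1 = 1 by [].
have h22 : h p2 p2 = 1.
  rewrite formE rmorph0 !conj_real.
  by transitivity (a%:C ^+ 2 + d%:C ^+ 2 : R[i]); [ring | rewrite dC; ring].
have h12 : h p1 p2 = a%:C.
  by rewrite p1E formE rmorph0 !conj_real; ring.
have h31 : h p3 p1 = c%:C * eps.
  by rewrite p1E formE rmorph1 !rmorph0; ring.
have gJ : g^*%R = (b%:C - a%:C * (c%:C * eps^*%R)) / d%:C.
  by rewrite /g rmorphM fmorphV rmorphB !rmorphM /= !conj_real.
have h23 : h p2 p3 = b%:C.
  by rewrite formE gJ rmorphM /= conj_real; field.
have h33 : h p3 p3 = 1.
  rewrite formE gJ rmorphM /= !conj_real.
  have fC : f%:C ^+ 2 * d%:C ^+ 2 = a%:C ^+ 2 + b%:C ^+ 2 + c%:C ^+ 2 - 1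
      - a%:C * b%:C * c%:C * (eps + eps^*%R) :> R[i].
    transitivity ((f ^+ 2 * d ^+ 2)%:C : R[i]); first by ring.
    by rewrite fE dE /f2 divfK ?gt_eqF// eps_re; ring.
  have d2nz : d%:C ^+ 2 != 0 :> R[i] by rewrite expf_neq0.
  apply: (mulIf d2nz); rewrite mulrBl -(expr2 f%:C) fC mul1r dC.
  transitivity (c%:C ^+ 2 * (eps * eps^*%R) * (1 - a%:C ^+ 2) + (b%:C ^+ 2
    - a%:C * b%:C * c%:C * (eps + eps^*%R) + a%:C ^+ 2 * c%:C ^+ 2 * (eps * eps^*%R))
    - (a%:C ^+ 2 + b%:C ^+ 2 + c%:C ^+ 2 - 1
      - a%:C * b%:C * c%:C * (eps + eps^*%R)) : R[i]); last by rewrite eps_norm; ring.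
  by rewrite /g -dC; field.
exists p1, p2, p3; split; last first.
  rewrite /triangle_param /varkappa h11 h22 h33 h12 h23 h31 !mulr1 divr1.
  have -> : a%:C * b%:C * (c%:C * eps) = (a * b * c)%:C * eps by ring.
  have n0 : 0 < a * b * c by rewrite !mulr_gt0.
  have eps1 : `|eps| = 1.
    by apply/eqP; rewrite -(@eqrXn2 _ 2)// expr1n normCK eps_norm.
  rewrite normrM eps1 mulr1 ger0_norm ?ler0c ?(ltW n0)// mulrAC divff ?mul1r//.
  by rewrite eq_complex /= eqxx andbT gt_eqF.
have h21 : h p2 p1 = a%:C by rewrite hermJ h12 conj_real.
have h32 : h p3 p2 = b%:C by rewrite hermJ h23 conj_real.
have h13 : h p1 p3 = c%:C * eps^*%R by rewrite hermJ h31 rmorphM /= conj_real.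
split; first by rewrite h11 h22 h33.
- split; apply: meet_at_angle_unit => //.
  + by rewrite h12 h21 -/a; ring.
  + by rewrite h23 h32 -/b; ring.
  + transitivity (c%:C ^+ 2 * (eps * eps^*%R)); first by rewrite h31 h13; ring.
    by rewrite eps_norm -/c; ring.
set U := <<_>>%VS => x _ xU; apply: (herm_nondeg sgnV) => y.
have p1U : p1 \in U by rewrite memv_span// !inE eqxx.
have p2U : p2 \in U by rewrite memv_span// !inE eqxx orbT.
have p3U : p3 \in U by rewrite memv_span// !inE eqxx !orbT.
have e2U : e2 \in U.
  have -> : e2 = (d%:C)^-1 *: (p2 - a%:C *: p1).
    by rewrite /p2 /p1 scale0r addr0 addrAC subrr add0r scalerA mulVf// scale1r.
  by rewrite memvZ// memvB// memvZ.
have e3U : e3 \in U.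
  have -> : e3 = (f%:C)^-1 *: (p3 - ((c%:C * eps) *: p1 + g *: e2)).
    by rewrite /p3 /p1 addrAC subrr add0r scalerA mulVf// scale1r.
  by rewrite memvZ// memvB// memvD// memvZ.
have [y1 [y2 [y3 ->]]] := span y.
by apply: xU; rewrite !memvD// memvZ.
Qed.
End Existence.

(** * The type of a triple *)

Section Deformation.
Context {R : realType} {V : vectType R[i]}.
Variable h : {hermitian_sym V for Num.conj}.
Hypothesis dimV : \dim (fullv : {vspace V}) = 3%N.
Hypothesis sgnV : signature_ppm h.
Local Notation r_ n := (@r_ R n).
Local Notation d_ n := (@cosine_defect R n).

Variables n1 n2 n3 : nat.
Hypotheses (n1_ge4 : (3 < n1)%N) (n2_ge4 : (3 < n2)%N) (n3_ge4 : (3 < n3)%N).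
Let s := r_ n1 ^+ 2 + r_ n2 ^+ 2 + r_ n3 ^+ 2.
Let m := r_ n1 * r_ n2 * r_ n3.

Let m_gt0 : 0 < m.
Proof. by rewrite !mulr_gt0// r_gt0// ltnW. Qed.

(** The number 2 Re (tr W_B) + 3 at the parameter t. *)
Definition trace_coord (t : R) := 9 - 8 * s + 16 * (m * t).

(** The bound v < 1 says that t < t_M, and the second hypothesis that the circle
of traces has a point with this real part, so that |t| <= 1. *)
Lemma param_at v : v < 1 -> 0 <= four_im_sq (d_ n1) (d_ n2) (d_ n3) v ->
  exists t, [/\ -1 <= t <= t_max n1 n2 n3, trace_coord t = v &
    exists p1 p2 p3 : V,
      triangle h n1 n2 n3 p1 p2 p3 /\ triangle_param h p1 p2 p3 = t].
Proof.
move=> v1 im; pose t := (v - 9 + 8 * s) / (16 * m).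
have m16 : 0 < 16 * m by rewrite mulr_gt0.
have mt : 16 * (m * t) = v - 9 + 8 * s by rewrite /t; field; rewrite gt_eqF.
have tM : 2 * (m * t) < s - 1.
  have mt2 : 2 * (m * t) = (v - 9 + 8 * s) / 8.
    by rewrite /t; field; rewrite gt_eqF.
  rewrite -subr_gt0 mt2 (_ : _ - _ = (1 - v) / 8); last by field.
  by rewrite divr_gt0// subr_gt0.
have t1 : -1 <= t <= 1.
  rewrite -ler_norml -(@ler_pXn2r _ 2)// ?nnegrE// expr1n real_normK ?num_real//.
  rewrite expr_div_n ler_pdivrMr ?exprn_gt0// mul1r -subr_ge0.
  rewrite (_ : _ - _ = four_im_sq (d_ n1) (d_ n2) (d_ n3) v)//.
  by rewrite /four_im_sq /disc_const /disc_slope /cosine_defect /m /s; ring.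
have [t1l t1r] := andP t1.
exists t; split.
- rewrite t1l /t_max le_min t1r andbT /t_M -/s.
  have -> : 2 * r_ n1 * r_ n2 * r_ n3 = 2 * m by rewrite /m; ring.
  have m2 : 0 < 2 * m by rewrite mulr_gt0.
  by rewrite (ler_pdivlMr _ _ m2) (_ : t * _ = 2 * (m * t)) ?ltW//; ring.
- by rewrite /trace_coord mt; ring.
- exact: triangle_exists.
Qed.

Lemma trace_coord_le t t' : t' <= t -> trace_coord t' <= trace_coord t.
Proof. by move=> tt; rewrite lerD2l !ler_pM2l. Qed.

Lemma type_A_criterion v : v < 1 -> 0 <= four_im_sq (d_ n1) (d_ n2) (d_ n3) v ->
  threshold_A (d_ n1) (d_ n2) (d_ n3) < v ->
  (forall w, w <= v -> 0 <= disc_B (d_ n1) (d_ n2) (d_ n3) w) ->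
  type_A h n1 n2 n3.
Proof.
move=> v1 im vAv nB.
have [t [t_bound tE [p1 [p2 [p3 [tri par]]]]]] := param_at v1 im.
exists t; split=> //.
  exists p1, p2, p3; split=> //.
  apply/(word_A_ellipticP dimV sgnV n1_ge4 n2_ge4 n3_ge4 tri par).
  by rewrite -/m -/s -[X in _ < X]/(trace_coord t) tE.
move=> t' /andP[_ tt'] [q1 [q2 [q3 [tri' par' ell]]]].
have /(word_B_ellipticP dimV sgnV n1_ge4 n2_ge4 n3_ge4 tri' par') := ell.
rewrite -/m -/s -[X in disc_B _ _ _ X]/(trace_coord t').
by rewrite ltNge nB// -tE trace_coord_le.
Qed.

Lemma type_B_criterion v : v < 1 -> 0 <= four_im_sq (d_ n1) (d_ n2) (d_ n3) v ->
  v <= threshold_A (d_ n1) (d_ n2) (d_ n3) ->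
  disc_B (d_ n1) (d_ n2) (d_ n3) v < 0 -> type_B h n1 n2 n3.
Proof.
move=> v1 im vvA discv.
have [t [t_bound tE [p1 [p2 [p3 [tri par]]]]]] := param_at v1 im.
exists t; split=> //.
  exists p1, p2, p3; split=> //.
  apply/(word_B_ellipticP dimV sgnV n1_ge4 n2_ge4 n3_ge4 tri par).
  by rewrite -/m -/s -[X in disc_B _ _ _ X]/(trace_coord t) tE.
move=> t' /andP[_ tt'] [q1 [q2 [q3 [tri' par' ell]]]].
have /(word_A_ellipticP dimV sgnV n1_ge4 n2_ge4 n3_ge4 tri' par') := ell.
rewrite -/m -/s -[X in _ < X]/(trace_coord t').
by rewrite ltNge (le_trans _ vvA)// -tE trace_coord_le.
Qed.
End Deformation.

Theorem mainTheorem1 (R : realType) (V : vectType R[i])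
    (h : {hermitian_sym V for Num.conj})
    (dimV : \dim (fullv : {vspace V}) = 3%N) (sgnV : signature_ppm h)
    (n1 n2 n3 : nat) (le12 : (n1 <= n2)%N) (le23 : (n2 <= n3)%N)
    (gt1 : (3 < n1)%N) :
  ((n1 <= 9)%N -> type_A h n1 n2 n3) /\
  ((14 <= n1)%N -> type_B h n1 n2 n3).
Proof.
have gt2 : (3 < n2)%N by exact: leq_trans le12.
have gt3 : (3 < n3)%N by exact: leq_trans le23.
have d3 := @cosine_defect_gt0 R _ gt3.
have d32 := @cosine_defect_le R _ _ gt2 le23.
have d21 := @cosine_defect_le R _ _ gt1 le12.
split=> n1_bound.
  have [|v [v1 im vAv nB]] := typeA_witness _ d3 d32 d21.
    have := @cosine_defect_le R _ _ gt1 n1_bound.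
    have := @cosine_defect_le R 4 _ isT gt1.
    rewrite /cosine_defect r4_sq => d1 d9; apply/andP; split; last by lra.
    by have := @r9_lt R; lra.
  exact: type_A_criterion v1 im vAv nB.
have [|v [v1 im vvA discv]] := typeB_witness _ d3 d32 d21.
  have := @cosine_defect_le R 14 _ isT n1_bound.
  by have := @r14_ge R; rewrite /cosine_defect; lra.
exact: type_B_criterion v1 im vvA discv.
Qed.
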